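(* Let $1\le p<\infty$, let $T:X_1\times\cdots\times X_m\to Y$ be an $m$-linear mapping between Banach spaces and let $\Phi:V_m\to C(B_{(X_1\otimes_\pi\cdots\otimes_\pi X_m)^*})$ be a bounded homogeneous map. Then $T$ is strongly $\Phi$-abstract $p$-summing if and only if there are a regular Borel probability measure $\eta$ on $B_{(X_1\otimes_\pi\cdots\otimes_\pi X_m)^*}$, with associated domination space $(\widehat{V_m})_\Phi^{L^p}$ defined by $\Phi$ and $L^p(\eta)$, and a continuous linear operator $\widehat T:(\widehat{V_m})_\Phi^{L^p}\to Y$ such that $$T=\widehat T\circ i_{(\widehat{V_m})_\Phi^{L^p}}\circ i_m.$$
   Context: $X_1\otimes_\pi\cdots\otimes_\pi X_m$ is the tensor product with the projective norm; its dual is identified with the space $\mathcal L(X_1,\dots,X_m)$ of continuous scalar $m$-linear forms. $B:=B_{(X_1\otimes_\pi\cdots\otimes_\pi X_m)^*}$ is its closed unit ball with the weak* topology (compact Hausdorff), and $C(B)$ is the space of continuous functions on $B$ with the supremum norm. For $x^j\in X_j$, $i_m(x^1,\dots,x^m)=\langle x^1\otimes\cdots\otimes x^m,\cdot\rangle\in C(B)$ is the function $\varphi\mapsto\varphi(x^1,\dots,x^m)$; $V_m\subset C(B)$ is the linear span of $i_m(X_1\times\cdots\times X_m)$. A (not necessarily linear) map $\Phi$ is homogeneous if $\Phi(\lambda v)=\lambda\Phi(v)$ for all real $\lambda>0$ and all $v$, and bounded if there is a constant $K$ with $\|\Phi(v)\|\le K\|v\|$ for all $v$. $T$ is strongly $\Phi$-abstract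 $p$-summing if there is $C>0$ such that for all $n_1,n_2\in\mathbb N$, $x_i^{j,k}\in X_j$ and scalars $\lambda_i^k$ ($1\le i\le n_1$, $1\le k\le n_2$, $1\le j\le m$), $$\Big(\sum_{i=1}^{n_1}\Big\|\sum_{k=1}^{n_2}\lambda_i^kT(x_i^{1,k},\dots,x_i^{m,k})\Big\|^p\Big)^{1/p}\le C\Big\|\Big(\sum_{i=1}^{n_1}\Big|\Phi\Big(\sum_{k=1}^{n_2}\lambda_i^k\langle x_i^{1,k}\otimes\cdots\otimes x_i^{m,k},\cdot\rangle\Big)\Big|^p\Big)^{1/p}\Big\|_{C(B)}.$$ Domination space: given $\eta$, put for $v\in V_m$ $$\|v\|_{\Phi,L^p}:=\inf\Big\{\sum_{i=1}^r\Big(\int_B|\Phi(v_i)|^p\,d\eta\Big)^{1/p}:\ r\in\mathbb N,\ v_i\in V_m,\ v=\sum_{i=1}^rv_i\Big\}.$$ It is a standing assumption that, for every $\eta$, this functional is a seminorm on $V_m$ that is continuous for the norm of $V_m$. Let $N=\{v\in V_m:\|v\|_{\Phi,L^p}=0\}$. Then $(\widehat{V_m})_\Phi^{L^p}$ is the completion of $V_m/N$ with the induced norm and $i_{(\widehat{V_m})_\Phi^{L^p}}:V_m\to(\widehat{V_m})_\Phi^{L^p}$ is the quotient map $v\mapsto[v]$. *)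

(* Defs.v *)
From HB Require Import structures.
From mathcomp Require Import all_boot all_order all_algebra.
From mathcomp Require Import complex.
From mathcomp Require Import all_classical all_reals all_analysis.

Set Implicit Arguments.
Unset Strict Implicit.
Unset Printing Implicit Defensive.

Import Order.TTheory GRing.Theory Num.Theory.
Import numFieldTopology.Exports numFieldNormedType.Exports.

Local Open Scope classical_set_scope.
Local Open Scope ring_scope.

Inductive scalar_kind := RealScalars | ComplexScalars.

Definition scalars (R : realType) (k : scalar_kind) : numFieldType :=
  match k with
  | RealScalars => R : numFieldType
  | ComplexScalars => R[i] : numFieldType
  end.

Definition to_real (R : realType) (k : scalar_kind) : scalars R k -> R :=
  match k return scalars R k -> R with
  | RealScalars => fun a => a
  | ComplexScalars => fun a => complex.Re a
  end.

(* Library norms over R[i] take values in R[i]. *)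
Definition rnorm (R : realType) (k : scalar_kind)
    (V : normedZmodType (scalars R k)) (v : V) : R :=
  to_real `|v|.

Section Multilinear.
Context (R : realType) (k : scalar_kind) (m : nat).
Local Notation K := (scalars R k).
Context (X : 'I_m -> lmodType K) (Z : lmodType K).

(* [dfwith x j u] is [x] with its [j]-th entry replaced by [u : X j]. *)
Definition multilinear (T : (forall j, X j) -> Z) : Prop :=
  forall (x : forall j, X j) (j : 'I_m) (a : K) (u v : X j),
    T (dfwith x j (a *: u + v)) = a *: T (dfwith x j u) + T (dfwith x j v).

End Multilinear.

Section Tensor.
Context (R : realType) (k : scalar_kind) (m : nat).
Local Notation K := (scalars R k).
Context (X : 'I_m -> completeNormedModType K).

(** An element of the algebraic tensor product is given by a formal sum
    [:: (a_1, x_1); ...; (a_n, x_n)], read as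
    a_1 x_1^1 (x) ... (x) x_1^m + ... + a_n x_n^1 (x) ... (x) x_n^m. *)
Definition tensor : Type := seq (K * (forall j, X j)).

Definition pairing (f : (forall j, X j) -> K^o) (u : tensor) : K^o :=
  \sum_(t <- u) t.1 *: f t.2.

(* Two formal sums denote the same tensor iff no m-linear form separates
   them. *)
Definition tensor_eq (u w : tensor) : Prop :=
  forall f : (forall j, X j) -> K^o, multilinear f -> pairing f u = pairing f w.

Definition projective_norm (u : tensor) : R :=
  inf [set \sum_(t <- w) rnorm t.1 * \prod_(j < m) rnorm (t.2 j)
      | w in [set w | tensor_eq u w]].

(** The closed unit ball of the dual of the projective tensor product, the dual
    being identified with the continuous m-linear forms. *)
Record dual_ball : Type := DualBall {
  dual_form :> (forall j, X j) -> K^o ;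
  form_multilinear : multilinear dual_form ;
  form_continuous : continuous (dual_form : prod_topology X -> K^o) ;
  form_le1 : forall u, rnorm (pairing dual_form u) <= projective_norm u
}.

HB.instance Definition _ := gen_eqMixin dual_ball.
HB.instance Definition _ := gen_choiceMixin dual_ball.

Definition weak_star_embedding (phi : dual_ball) : {ptws tensor -> K^o} :=
  pairing phi.

HB.instance Definition _ :=
  Topological.copy dual_ball (initial_topology weak_star_embedding).

Definition zero_form : (forall j, X j) -> K^o := fun=> 0.

Lemma zero_multilinear : multilinear zero_form.
Proof. by move=> x j a u v; rewrite /zero_form scaler0 addr0. Qed.

Lemma zero_continuous : continuous (zero_form : prod_topology X -> K^o).
Proof. exact: cst_continuous. Qed.

Lemma rnorm_ge0 (V : normedZmodType K) (v : V) : 0 <= rnorm v.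
Proof.
rewrite /rnorm; move: (normr_ge0 v).
by case: k V v => V v /=; rewrite // lecE => /andP[].
Qed.

Lemma projective_norm_ge0 (u : tensor) : 0 <= projective_norm u.
Proof.
apply: lb_le_inf; first by eexists; exists u.
move=> _ [w _ <-]; apply: sumr_ge0 => t _.
by rewrite mulr_ge0 ?rnorm_ge0//; apply: prodr_ge0 => j _; exact: rnorm_ge0.
Qed.

Lemma zero_le1 u : rnorm (pairing zero_form u) <= projective_norm u.
Proof.
rewrite /pairing big1 => [|t _]; last by rewrite scaler0.
suff -> : rnorm (0 : K^o) = 0 by exact: projective_norm_ge0.
by rewrite /rnorm normr0; case: k.
Qed.

HB.instance Definition _ :=
  isPointed.Build dual_ball (DualBall zero_multilinear zero_continuous zero_le1).

Definition borel_dual_ball := g_sigma_algebraType (@open dual_ball).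

Definition regular_measure (eta : probability borel_dual_ball R) : Prop :=
  forall A : set dual_ball, measurable (A : set borel_dual_ball) ->
    eta A = ereal_inf [set eta U | U in [set U | open U /\ A `<=` U]] /\
    eta A = ereal_sup [set eta C | C in [set C | compact C /\ C `<=` A]].

Definition sup_norm (g : dual_ball -> R) : R := sup (range (fun phi => `|g phi|)).

Definition normC (f : dual_ball -> K^o) : R := sup_norm (fun phi => rnorm (f phi)).

Definition elementary (x : forall j, X j) : dual_ball -> K^o := fun phi => phi x.

Definition Vm_set : set (dual_ball -> K^o) :=
  [set v | exists (n : nat) (a : 'I_n -> K) (x : 'I_n -> forall j, X j),
    v = \sum_(i < n) a i *: elementary (x i)].

Definition Vm_pred : {pred dual_ball -> K^o} := fun v => `[< Vm_set v >].

Lemma Vm_submod : submod_closed Vm_pred.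
Proof.
split=> [|a v w /asboolP[n [b [x ->]]] /asboolP[n' [b' [x' ->]]]]; apply/asboolP.
  exists 0%N, (fun=> 0), (fun _ _ => 0).
  by rewrite big_ord0.
exists (n + n')%N,
  (fun i => match fintype.split i with inl i => a * b i | inr i => b' i end),
  (fun i => match fintype.split i with inl i => x i | inr i => x' i end).
rewrite big_split_ord /= scaler_sumr; congr (_ + _); apply: eq_bigr => i _.
  by case: split_ordP => i0; [move/lshift_inj <-; rewrite scalerA |
    move/eqP; rewrite eq_lrshift].
by case: split_ordP => i0; [move/eqP; rewrite eq_rlshift | move/rshift_inj <-].
Qed.

HB.instance Definition _ :=
  GRing.isSubmodClosed.Build K (dual_ball -> K^o) Vm_pred Vm_submod.

Record Vm : Type := MkVm {
  Vm_fun :> dual_ball -> K^o ;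
  Vm_funP : Vm_fun \in Vm_pred
}.

HB.instance Definition _ := [isSub for Vm_fun].
HB.instance Definition _ := [Choice of Vm by <:].
HB.instance Definition _ := [SubChoice_isSubLmodule of Vm by <:].

Lemma Vm_continuous (v : Vm) : continuous v.
Proof.
case: v => _ /= /asboolP[n [a [x ->]]].
have pairing_continuous (u : tensor) :
    continuous ((fun phi => pairing phi u) : dual_ball -> K^o).
  move=> phi.
  apply: (@continuous_comp _ _ _ weak_star_embedding
    (fun g : {ptws tensor -> K^o} => g u)).
    exact: initial_continuous.
  exact: proj_continuous.
pose u : tensor := [seq (a i, x i) | i <- index_enum 'I_n].
suff -> : \sum_(i < n) a i *: elementary (x i)
    = (fun phi => pairing phi u) :> (dual_ball -> K^o).
  exact: pairing_continuous.
apply/funext => phi; rewrite /pairing big_map.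
by rewrite (big_morph (fun f : dual_ball -> K^o => f phi) (op1 := +%R) (id1 := 0)).
Qed.

Lemma elementary_in_Vm (x : forall j, X j) : elementary x \in Vm_pred.
Proof.
apply/asboolP; exists 1%N, (fun=> 1), (fun=> x).
by rewrite big_ord1 scale1r.
Qed.

Definition i_m (x : forall j, X j) : Vm := MkVm (elementary_in_Vm x).

Section Phi.
Context (Phi : Vm -> continuousType dual_ball K^o).

(* In R[i], [0 < a] forces [a] to be real. *)
Definition homogeneous : Prop :=
  forall (a : K) (v : Vm), 0 < a ->
    forall phi, Phi (a *: v) phi = a *: Phi v phi.

Definition bounded_map : Prop :=
  exists M : R, forall v : Vm, normC (Phi v) <= M * normC v.

Definition strongly_abstract_summing (p : R) (Y : completeNormedModType K)
    (T : (forall j, X j) -> Y) : Prop :=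
  exists2 C : R, 0 < C &
  forall (n1 n2 : nat) (x : 'I_n1 -> 'I_n2 -> forall j, X j)
         (a : 'I_n1 -> 'I_n2 -> K),
    (\sum_(i < n1) rnorm (\sum_(l < n2) a i l *: T (x i l)) `^ p) `^ p^-1
    <= C * sup_norm (fun phi =>
         (\sum_(i < n1) rnorm (Phi (\sum_(l < n2) a i l *: i_m (x i l)) phi) `^ p)
           `^ p^-1).

(* The infimum is finite: the family reduced to [v] has a finite sum. *)
Definition domination_norm (p : R) (eta : probability borel_dual_ball R)
    (v : Vm) : R :=
  fine (ereal_inf [set s | exists (r : nat) (w : 'I_r -> Vm),
    v = \sum_(i < r) w i /\
    s = (\sum_(i < r)
           Lnorm eta p%:E (fun phi => (rnorm (Phi (w i) phi))%:E))%E]).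

End Phi.

Definition continuous_on_Vm (N : Vm -> R) : Prop :=
  forall (v : Vm) (e : R), 0 < e ->
    exists2 d : R, 0 < d & forall w : Vm, normC (w - v) < d -> `|N w - N v| < e.

End Tensor.

Section Completion.
Context (R : realType) (k : scalar_kind).
Local Notation K := (scalars R k).
Context (V : lmodType K) (N : V -> R).

Definition seminorm : Prop :=
  (forall v, 0 <= N v) /\
  (forall v w, N (v + w) <= N v + N w) /\
  (forall (a : K) v, N (a *: v) = rnorm a * N v).

(** For a seminorm [N], the completion of V / {v | N v = 0}, which is unique up
    to an isometry commuting with the maps from V: the norm identity says that
    [quotient_map] vanishes exactly on {v | N v = 0} and induces an isometry on
    the quotient. *)
Record completion : Type := Completion {
  completion_space :> completeNormedModType K ;
  quotient_map : {linear V -> completion_space} ;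
  norm_quotient_map : forall v, rnorm (quotient_map v) = N v ;
  dense_quotient_map : dense (range quotient_map)
}.

End Completion.

(* Main.v *)
(** A Pietsch-type domination argument. The summing inequality makes
    [S : sum_l a_l i_m(x_l) |-> sum_l a_l T(x_l)] a well-defined linear map on [V_m] with
    [sum_i |S v_i|^p <= C^p sup_phi sum_i |Phi(v_i)(phi)|^p]. By homogeneity of [Phi] the
    functionals [g_v = C^p |Phi v|^p - |S v|^p] form a cone of functions with nonnegative
    supremum, so Hahn-Banach gives a mean [L] on the bounded functions on the dual ball with
    [L g_v >= 0] for all [v]. The finitely additive set function [A |-> L 1_A] is made into a
    regular Borel probability by taking suprema over closed subsets of open sets; the dual ball
    being compact (Tychonoff), no mass is lost, and the layer-cake formula gives
    [L f <= int f d eta] for [f >= 0] continuous. Hence [|S v| <= C |v|_{Phi,L^p}], so [S]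
    extends to the completion. The converse follows by integrating. *)

Require Import Defs.
From HB Require Import structures.
From mathcomp Require Import all_boot all_order all_algebra.
From mathcomp Require Import complex ring lra.
From mathcomp Require Import all_classical all_reals all_analysis.
From mathcomp Require Import measurable_realfun.

Set Implicit Arguments.
Unset Strict Implicit.
Unset Printing Implicit Defensive.

Import Order.TTheory GRing.Theory Num.Theory.
Import numFieldTopology.Exports numFieldNormedType.Exports.

Local Open Scope classical_set_scope.
Local Open Scope ring_scope.

(** * Scalars and real-valued norms *)

Section Scalars.
Context (R : realType) (k : scalar_kind).
Local Notation K := (scalars R k).

(** [Phi] need not be linear, so the functions [|Phi v|^p] form no subspace on which a functional
    could be prescribed. Only positive multiples survive, since [t |Phi v|^p = |Phi (t^(1/p) v)|^p];
    hence the detour through a sublinear functional built from finite sums of gaps. The mean [L]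
    lives on all bounded functions so that indicators of arbitrary sets lie in its domain and a set
    function can be read off at once. The price is that [eta] need not agree with [A |-> L 1_A]:
    mass lying in every neighbourhood of a closed set but not on it is moved onto that set. This
    only increases the values on closed sets, and the superlevel sets of [|Phi v|^p] at positive
    heights are closed, so the inequality survives in the direction that domination needs. The
    infimum over decompositions in the domination norm costs nothing, because [S] is linear and the
    triangle inequality applies to the sum of the [S w_i]. *)

Definition of_real : R -> K :=
  match k return R -> scalars R k with
  | RealScalars => fun r => r
  | ComplexScalars => fun r => real_complex R r
  end.

Lemma of_realK : cancel of_real (@to_real R k).
Proof. by rewrite /of_real; case: k. Qed.

Lemma of_real0 : of_real 0 = 0. Proof. by rewrite /of_real; case: k. Qed.

Lemma of_real1 : of_real 1 = 1. Proof. by rewrite /of_real; case: k. Qed.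

Lemma of_realD (a b : R) : of_real (a + b) = of_real a + of_real b.
Proof. by rewrite /of_real; case: k => //; exact: rmorphD. Qed.

Lemma of_realM (a b : R) : of_real (a * b) = of_real a * of_real b.
Proof. by rewrite /of_real; case: k => //; exact: rmorphM. Qed.

Lemma le_of_real (a b : R) : (of_real a <= of_real b) = (a <= b).
Proof. by rewrite /of_real; case: k => //=; rewrite lecR. Qed.

Lemma lt_of_real (a b : R) : (of_real a < of_real b) = (a < b).
Proof. by rewrite /of_real; case: k => //=; rewrite ltcR. Qed.

(** The order of [R[i]] makes nonnegative elements real, so every library norm is the image of its
    real part. This transfers all estimates to [R] for both scalar fields at once. *)
Lemma ge0_of_real (a : K) : 0 <= a -> a = of_real (to_real a).
Proof.
rewrite /of_real /to_real; case: k a => //= a.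
by rewrite lecE => /andP[/eqP /= a0 _]; case: a a0 => ? ? /= ->.
Qed.

Lemma norm_of_real (V : normedZmodType K) (v : V) : `|v| = of_real (rnorm v).
Proof. exact: ge0_of_real. Qed.

Lemma norm_of_real_scalar (a : R) : `|of_real a| = of_real `|a|.
Proof.
rewrite /of_real; case: k => //=.
rewrite normc_def /= expr0n addr0 sqrtr_sqr; exact: erefl.
Qed.

Section Norm.
Variable V : normedZmodType K.
Implicit Types v w : V.

Lemma rnorm0 : rnorm (0 : V) = 0.
Proof. by rewrite /rnorm normr0 -of_real0 of_realK. Qed.

Lemma rnorm_eq0 v : rnorm v = 0 -> v = 0.
Proof. by move=> v0; apply/normr0_eq0; rewrite norm_of_real v0 of_real0. Qed.

Lemma rnormN v : rnorm (- v) = rnorm v.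
Proof. by rewrite /rnorm normrN. Qed.

Lemma rnormD v w : rnorm (v + w) <= rnorm v + rnorm w.
Proof. by rewrite -le_of_real of_realD -!norm_of_real ler_normD. Qed.

Lemma rnormB v w : rnorm (v - w) = rnorm (w - v).
Proof. by rewrite /rnorm distrC. Qed.

Lemma rnorm_sum n (f : 'I_n -> V) :
  rnorm (\sum_(i < n) f i) <= \sum_(i < n) rnorm (f i).
Proof.
elim/big_ind2 : _ => [|v a w b va wb|//]; first by rewrite rnorm0.
by rewrite (le_trans (rnormD _ _))// lerD.
Qed.

Lemma rnorm_dist v w : `|rnorm v - rnorm w| <= rnorm (v - w).
Proof.
rewrite ler_norml; apply/andP; split.
  have := rnormD (w - v) v; rewrite subrK rnormB; lra.
have := rnormD (v - w) w; rewrite subrK; lra.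
Qed.

End Norm.

Lemma rnorm_of_real (a : R) : rnorm (of_real a) = `|a|.
Proof. by rewrite /rnorm norm_of_real_scalar of_realK. Qed.

Lemma rnormM (a b : K) : rnorm (a * b) = rnorm a * rnorm b.
Proof. by rewrite /rnorm normrM !norm_of_real -of_realM !of_realK. Qed.

Section NormedModule.
Variable V : normedModType K.

Lemma rnormZ (a : K) (v : V) : rnorm (a *: v) = rnorm a * rnorm v.
Proof. by rewrite /rnorm normrZ !norm_of_real -of_realM !of_realK. Qed.

(** Balls of real radius generate the topology; from here on, topological arguments need no
    distinction between the two fields. *)
Lemma nbhs_rnorm (x : V) (A : set V) :
  nbhs x A <-> exists2 e : R, 0 < e & forall y, rnorm (y - x) < e -> A y.
Proof.
split=> [/nbhs_normP[e /= e0 xA]|[e e0 xA]].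
  exists (to_real e).
    by rewrite -lt_of_real of_real0 -ge0_of_real// ltW.
  move=> y; rewrite -lt_of_real -ge0_of_real ?ltW// -norm_of_real => yx.
  by apply: xA; rewrite /= distrC.
apply/nbhs_normP; exists (of_real e); first by rewrite /= -of_real0 lt_of_real.
by move=> y /=; rewrite distrC norm_of_real lt_of_real; exact: xA.
Qed.

Lemma rnorm_continuous : continuous (@rnorm R k V).
Proof.
move=> x; apply/cvgrPdist_lt => e e0; apply/nbhs_rnorm; exists e => // y yx.
by rewrite distrC; apply: le_lt_trans yx; exact: rnorm_dist.
Qed.

Lemma cvg_rnorm T (F : set_system T) (FF : Filter F) (f : T -> V) (l : V) :
  f x @[x --> F] --> l <-> forall e : R, 0 < e -> \forall x \near F, rnorm (f x - l) < e.
Proof.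
split=> [fl e e0|fl A /nbhs_rnorm[e e0 eA]].
  suff /fl : nbhs l [set y | rnorm (y - l) < e] by [].
  by apply/nbhs_rnorm; exists e.
by rewrite /fmap /=; near=> x; apply: eA; near: x; exact: fl.
Unshelve. all: by end_near. Qed.

End NormedModule.

End Scalars.

(** The ball is a closed subset of a continuous image of a compact box: the segment [[-M, M]], or
    its square in the complex case. These balls are the factors of the Tychonoff product that
    contains the dual ball. *)
Lemma rnorm_ball_compact (R : realType) (k : scalar_kind) (M : R) :
  compact [set a : (scalars R k)^o | rnorm a <= M].
Proof.
have sub_image (T : topologicalType) (A : set T) (f : T -> (scalars R k)^o) :
    compact A -> continuous f -> (forall a, rnorm a <= M -> (f @` A) a) ->
    compact [set a : (scalars R k)^o | rnorm a <= M].
  move=> cA fcont fA; have cfA := continuous_compact (continuous_subspaceT fcont) cA.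
  apply: (subclosed_compact _ cfA) => //.
  apply: (@closed_comp _ _ (@rnorm R k _) [set x | x <= M]); last exact: closed_le.
  by move=> x _; exact: rnorm_continuous.
case: k sub_image => sub_image.
  apply: (sub_image R _ id (@segment_compact R (- M) M)).
    move=> x; apply/cvg_rnorm => e e0; near=> y.
    by rewrite rnormB; near: y; exact: cvgr_dist_lt.
  by move=> a aM; exists a => //=; rewrite in_itv /= -ler_norml.
pose f (ab : R * R) : (scalars R ComplexScalars)^o := (Complex ab.1 ab.2 : R[i]).
have cpt : compact ([set` `[- M, M]] `*` [set` `[- M, M]] : set (R * R)).
  by apply: compact_setX; exact: segment_compact.
have rnormE (a b : R) : rnorm (f (a, b)) = Num.sqrt (a ^+ 2 + b ^+ 2).
  by rewrite /rnorm -[`|_|]/(`|(Complex a b : R[i])|) normc_def.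
apply: (sub_image _ _ f cpt).
  move=> [a b]; apply/cvg_rnorm => e e0.
  have e20 : 0 < e / 2 by rewrite divr_gt0.
  near=> ab.
  have -> : f ab - f (a, b) = f (ab.1 - a, ab.2 - b) by [].
  rewrite rnormE; apply: (@le_lt_trans _ _ (`|ab.1 - a| + `|ab.2 - b|)).
    rewrite -[leRHS]ger0_norm ?addr_ge0// -sqrtr_sqr ler_wsqrtr//.
    rewrite [leRHS]sqrrD !real_normK ?num_real// lerD2r lerDl.
    by rewrite mulrn_wge0// mulr_ge0.
  rewrite (splitr e) ltrD// distrC; near: ab.
    by move: (e / 2) e20; apply/cvgrPdist_lt; exact: cvg_fst.
  by move: (e / 2) e20; apply/cvgrPdist_lt; exact: cvg_snd.
move=> [a b]; rewrite -[X in rnorm X]/(f (a, b)) rnormE => abM; exists (a, b) => //.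
rewrite /= !in_itv /= -!ler_norml.
by split; apply: le_trans abM; rewrite -sqrtr_sqr ler_wsqrtr// ?lerDl ?lerDr sqr_ge0.
Unshelve. all: by end_near. Qed.

(** * The Hahn-Banach theorem *)

Section HahnBanach.
Context (R : realType) (V : lmodType R).

(** Homogeneity is an inequality for [t > 0] only; used for [t] and for its inverse it gives
    equality, and the value at 0 follows in [sublinear0]. *)
Definition sublinear (q : V -> R) :=
  (forall x y, q (x + y) <= q x + q y) /\
  (forall (t : R) x, 0 < t -> q (t *: x) <= t * q x).

Lemma sublinear0 (q : V -> R) : sublinear q -> q 0 = 0.
Proof.
move=> [qD qZ]; apply/eqP; rewrite eq_le; apply/andP; split.
  by have := qZ 2^-1 0 ltac:(by []); rewrite scaler0; lra.
by have := qD 0 0; rewrite addr0; lra.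
Qed.

Lemma sublinear_geN (q : V -> R) x : sublinear q -> - q (- x) <= q x.
Proof.
move=> sq; have := sq.1 x (- x); rewrite subrr sublinear0//; lra.
Qed.

(* A sublinear functional that is minimal for the pointwise order is linear: for each [y],
   x |-> inf_(t >= 0) (q (x + t y) - t q y) is sublinear and below [q]. *)
Lemma minimal_sublinearD (q : V -> R) : sublinear q ->
  (forall f, sublinear f -> (forall x, f x <= q x) -> f = q) ->
  forall x y, q (x + y) = q x + q y.
Proof.
move=> sq qmin x y; apply/eqP; rewrite eq_le sq.1 /=.
pose S x := [set q (x + t *: y) - t * q y | t in [set t : R | 0 <= t]].
pose f x := inf (S x).
have tq t z : 0 <= t -> q (t *: z) <= t * q z.
  rewrite le0r => /predU1P[->|/sq.2//].
  by rewrite scale0r mul0r sublinear0.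
have Slb x' : lbound (S x') (- q (- x')).
  move=> _ [t /= t0 <-].
  have := sq.1 (x' + t *: y) (- x'); rewrite addrAC subrr add0r.
  suff : t * q y <= q (t *: y) by lra.
  move: t0; rewrite le0r => /predU1P[->|t0].
    by rewrite scale0r mul0r sublinear0.
  have := sq.2 t^-1 (t *: y); rewrite invr_gt0 scalerA mulVf ?gt_eqF// scale1r.
  by move=> /(_ t0); rewrite -ler_pdivrMl ?invr_gt0// invrK.
have S_inf x' : has_inf (S x').
  by split; [exists (q (x' + 0 *: y) - 0 * q y), 0 => /= | exists (- q (- x'))].
have fle x' t : 0 <= t -> f x' <= q (x' + t *: y) - t * q y.
  by move=> t0; apply: ge_inf; [have [] := S_inf x' | exists t].
have fleq x' : f x' <= q x'.
  by have := fle x' 0 (lexx _); rewrite scale0r mul0r addr0 subr0.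
have sf : sublinear f.
  split=> [u v|t u t0].
    have fge t s : 0 <= t -> 0 <= s ->
        f (u + v) <= q (u + t *: y) - t * q y + (q (v + s *: y) - s * q y).
      move=> t0 s0; apply: (le_trans (fle _ (t + s) _)); first exact: addr_ge0.
      have := sq.1 (u + t *: y) (v + s *: y).
      rewrite addrACA -scalerDl; lra.
    rewrite -lerBlDr; apply: lb_le_inf; first by have [] := S_inf u.
    move=> _ [t /= t0 <-]; rewrite lerBlDl -lerBlDr.
    apply: lb_le_inf; first by have [] := S_inf v.
    by move=> _ [s /= s0 <-]; rewrite lerBlDl; exact: fge.
  rewrite -ler_pdivrMl//; apply: lb_le_inf; first by have [] := S_inf u.
  move=> _ [s /= s0 <-]; rewrite ler_pdivrMl//.
  have ts0 : 0 <= t * s by rewrite mulr_ge0// ltW.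
  apply: (le_trans (fle _ _ ts0)).
  rewrite -scalerA -scalerDr mulrBr mulrA lerD2r; exact: sq.2.
have <- := qmin f sf fleq.
have := fle x 1 ler01; rewrite scale1r mul1r (qmin f sf fleq); lra.
Qed.

Lemma sublinear_additive_linear (q : V -> R) : sublinear q ->
  (forall x y, q (x + y) = q x + q y) ->
  forall (a : R) x y, q (a *: x + y) = a * q x + q y.
Proof.
move=> sq qD a x y; rewrite qD; congr (_ + _).
have qN z : q (- z) = - q z.
  have /eqP := qD z (- z); rewrite subrr sublinear0// eq_sym addrC addr_eq0.
  by move/eqP.
have qZ t z : 0 < t -> q (t *: z) = t * q z.
  move=> t0; apply/eqP; rewrite eq_le sq.2//=.
  have := sq.2 t^-1 (t *: z); rewrite invr_gt0 scalerA mulVf ?gt_eqF// scale1r.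
  by move=> /(_ t0); rewrite -ler_pdivrMl ?invr_gt0// invrK.
have [a0|a0|->] := ltgtP a 0; [|exact: qZ|].
  by rewrite -[a]opprK scaleNr qN qZ ?oppr_gt0// !mulNr.
by rewrite scale0r mul0r sublinear0.
Qed.

(** Zorn's lemma is applied to the sublinear functionals below [q] themselves; a minimal one is
    additive by [minimal_sublinearD], hence linear. *)
Theorem hahn_banach (q : V -> R) : sublinear q ->
  exists L : V -> R, (forall (a : R) x y, L (a *: x + y) = a * L x + L y) /\
    forall x, L x <= q x.
Proof.
move=> sq; pose P f := sublinear f /\ forall x, f x <= q x.
(* The order is reversed, so that a maximal element in Zorn's lemma is a minimal functional. *)
pose ge (f g : {f | P f}) := `[< forall x, sval g x <= sval f x >].
have [||||[f [sf fq]] fmin] := @Zorn {f | P f} ge.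
- by move=> f; apply/asboolP.
- move=> f g h /asboolP fg /asboolP gh; apply/asboolP => x.
  exact: le_trans (gh x) (fg x).
- move=> [f Pf] [g Pg] /asboolP/= fg /asboolP/= gf; apply/eq_exist/funext => x.
  by apply/eqP; rewrite eq_le fg gf.
- move=> A totA; have [[f0 Af0]|A0] := pselect (A !=set0); last first.
    have Pq : P q by split.
    by exists (exist _ q Pq) => f Af; exfalso; apply: A0; exists f.
  pose S x := [set sval f x | f in A].
  have S_inf x : has_inf (S x).
    split; first by exists (sval f0 x), f0.
    (* [- q (- x)] lies below every member of the chain at [x], so the pointwise infimum is
       finite. *)
    exists (- q (- x)) => _ [[f [sf fq]] /= _ <-].
    by have := sublinear_geN x sf; have := fq (- x); lra.
  pose g x := inf (S x).
  have gle f x : A f -> g x <= sval f x.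
    by move=> Af; apply: ge_inf; [have [] := S_inf x | exists f].
  have gge x c : (forall f, A f -> c <= sval f x) -> c <= g x.
    move=> cf; apply: lb_le_inf; first by have [] := S_inf x.
    by move=> _ [f Af <-]; exact: cf.
  have Pg : P g.
    split; last by move=> x; apply: (le_trans (gle _ x Af0)); case: f0 {Af0} => f [].
    split=> [x y|t x t0].
      rewrite -lerBlDr; apply: (gge x) => f1 Af1; rewrite lerBlDl -lerBlDr.
      apply: (gge y) => f2 Af2; rewrite lerBlDl.
      (* Chain members are comparable; the subadditivity of the smaller one, [f2], gives the
         bound. *)
      wlog /asboolP f12 : x y f1 f2 Af1 Af2 / ge f1 f2.
        move=> W; have [f12|f21] := totA _ _ Af1 Af2; first exact: W.
        by rewrite addrC [leRHS]addrC; exact: W.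
      apply: (le_trans (gle _ _ Af2)); apply: (@le_trans _ _ (sval f2 x + sval f2 y)).
        by case: f2 {Af2 f12} => f [[]].
      by rewrite lerD2r.
    rewrite -ler_pdivrMl//; apply: gge => f Af; rewrite ler_pdivrMl//.
    by apply: (le_trans (gle _ _ Af)); have [[_ fZ] _] := svalP f; exact: fZ.
  by exists (exist _ g Pg) => f Af; apply/asboolP => x; exact: gle.
exists f; split=> //; apply: sublinear_additive_linear => //.
apply: minimal_sublinearD => // g sg gf.
have Pg : P g by split=> // x; exact: le_trans (gf x) (fq x).
by have /(congr1 sval) := fmin (exist _ g Pg) (asboolT gf).
Qed.

End HahnBanach.

Section LinearFunctional.
Context (R : realType) (V : lmodType R) (L : V -> R).
Hypothesis L_linear : forall (a : R) x y, L (a *: x + y) = a * L x + L y.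

Lemma linear_functional0 : L 0 = 0.
Proof. by have := L_linear 1 0 0; rewrite scaler0 addr0 mul1r; lra. Qed.

Lemma linear_functionalD x y : L (x + y) = L x + L y.
Proof. by rewrite -[x in LHS]scale1r L_linear mul1r. Qed.

Lemma linear_functionalZ a x : L (a *: x) = a * L x.
Proof. by rewrite -[_ *: _]addr0 L_linear linear_functional0 addr0. Qed.

Lemma linear_functional_sum n (f : 'I_n -> V) :
  L (\sum_(i < n) f i) = \sum_(i < n) L (f i).
Proof.
rewrite (big_morph L (op1 := +%R) (id1 := 0)) ?linear_functional0//.
exact: linear_functionalD.
Qed.

End LinearFunctional.

(** * Regular measures from finitely additive set functions *)

Section RegularMeasure.
Context (R : realType) (T : ptopologicalType).
Hypotheses (T_compact : compact [set: T]) (T_hausdorff : hausdorff_space T).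
Variable nu : set T -> R.
Hypotheses (nu_ge0 : forall A, 0 <= nu A)
  (nuU : forall A B, A `&` B = set0 -> nu (A `|` B) = nu A + nu B)
  (nuT : nu setT = 1).

Lemma content0 : nu set0 = 0.
Proof. by have := nuU (setI0 set0); rewrite setU0; lra. Qed.

Lemma le_content A B : A `<=` B -> nu A <= nu B.
Proof.
by move=> AB; rewrite -(setDUK AB) nuU ?lerDl//; rewrite setDE setICA setICr setI0.
Qed.

Lemma content_le1 A : nu A <= 1.
Proof. by rewrite -nuT; exact: le_content. Qed.

Lemma contentU_le A B : nu (A `|` B) <= nu A + nu B.
Proof.
have -> : A `|` B = A `|` (B `\` A).
  apply/seteqP; split=> x [Ax|]; [by left| |by left|by case; right].
  by have [Ax|nAx] := pselect (A x); [left|right].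
rewrite nuU ?lerD2l; first by apply: le_content; exact: subDsetl.
by rewrite setDE setICA setICr setI0.
Qed.

(** On open sets only the mass carried by closed subsets is kept; [nu] itself need not be countably
    subadditive there. *)
Definition inner_content (U : set T) : \bar R :=
  ereal_sup [set (nu K)%:E | K in [set K | closed K /\ K `<=` U]].

Definition outer_content (A : set T) : \bar R :=
  ereal_inf [set inner_content U | U in [set U | open U /\ A `<=` U]].

Lemma inner_content_ge U K : closed K -> K `<=` U ->
  ((nu K)%:E <= inner_content U)%E.
Proof. by move=> cK KU; apply: ereal_sup_ubound; exists K. Qed.

Lemma inner_content_ge0 U : (0 <= inner_content U)%E.
Proof.
apply: le_trans (inner_content_ge closed0 (@sub0set _ U)).
by rewrite lee_fin.
Qed.

Lemma inner_content_le1 U : (inner_content U <= 1)%E.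
Proof. by apply: ge_ereal_sup => _ [K _ <-]; rewrite lee_fin content_le1. Qed.

Lemma inner_content_fin U : inner_content U \is a fin_num.
Proof.
rewrite ge0_fin_numE ?inner_content_ge0//.
by rewrite (le_lt_trans (inner_content_le1 U))// ltry.
Qed.

Lemma le_inner_content U V : U `<=` V -> (inner_content U <= inner_content V)%E.
Proof.
move=> UV; apply: ge_ereal_sup => _ [K [cK KU] <-].
by apply: inner_content_ge => //; exact: subset_trans UV.
Qed.

(** By normality, a closed [K] inside the union is cut into two closed pieces, one in [U] and one in
    [V]: some [W] has [K \ V] in its interior and its closure in [U]. The pieces may overlap, so
    subadditivity of [nu] is what is used. *)
Lemma inner_contentU U V : open U -> open V ->
  (inner_content (U `|` V) <= inner_content U + inner_content V)%E.
Proof.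
move=> oU oV; apply: ge_ereal_sup => _ [K [cK KUV] <-].
have cA : closed (K `\` V) by rewrite setDE; apply: closedI => //; exact: open_closedC.
have AU : set_nbhs (K `\` V) U.
  move=> x [Kx nVx]; apply: open_nbhs_nbhs; split=> //.
  by have [] := KUV _ Kx.
have [W AW cWU] := compact_normal T_hausdorff T_compact cA AU.
have c2 : closed (K `\` W°).
  by rewrite setDE; apply: closedI => //; apply: open_closedC; exact: open_interior.
have K2V : K `\` W° `<=` V.
  move=> x [Kx nWx]; apply: contrapT => nVx; apply: nWx.
  by apply: AW.
have K1U : K `&` closure W `<=` U by move=> x [_ /cWU].
have c1 : closed (K `&` closure W) by apply: closedI => //; exact: closed_closure.
apply: (@le_trans _ _ ((nu (K `&` closure W))%:E + (nu (K `\` W°))%:E)%E).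
  rewrite -EFinD lee_fin; apply: le_trans (contentU_le _ _); apply: le_content.
  move=> x Kx; have [Wx|nWx] := pselect (W° x); [left|by right].
  by split=> //; apply: subset_closure; exact: interior_subset.
by apply: leeD; exact: inner_content_ge.
Qed.

(** A closed subset of the union is compact and meets a finite subcover; this is how countable
    subadditivity arises from a finitely additive [nu]. *)
Lemma inner_content_bigcup (U : (set T)^nat) : (forall n, open (U n)) ->
  (inner_content (\bigcup_n U n) <= \sum_(n <oo) inner_content (U n))%E.
Proof.
move=> oU; apply: ge_ereal_sup => _ [K [cK KU] <-].
have U_fin n : (inner_content (\big[setU/set0]_(i < n) U i) <=
    \sum_(i < n) inner_content (U i))%E.
  elim: n => [|n IH].
    rewrite !big_ord0; apply: ge_ereal_sup => _ [A [_ A0] <-].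
    by rewrite (_ : A = set0) ?content0//; apply/seteqP; split.
  rewrite !big_ord_recr /=; apply: le_trans (leeD2r _ IH).
  apply: inner_contentU => //.
  by rewrite -bigcup_mkord; apply: bigcup_open.
have cptK : compact K by exact: subclosed_compact cK T_compact (@subsetT _ _).
move: cptK; rewrite compact_cover => /(_ nat setT U).
case=> [i _|x /KU [i _ Ux]|D _ KD]; [exact: oU|by exists i|].
pose n := (\max_(i <- finmap.enum_fset D) i).+1.
have KUn : K `<=` \big[setU/set0]_(i < n) U i.
  move=> x /KD [i /= iD Uix]; rewrite -bigcup_mkord; exists i => //=.
  by rewrite /n ltnS; exact: (leq_bigmax_seq (F := id)).
apply: (@le_trans _ _ (\sum_(i < n) inner_content (U i))%E).
  by apply: le_trans (U_fin n); exact: inner_content_ge.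
rewrite -(big_mkord xpredT (inner_content \o U)).
by apply: nneseries_lim_ge => i _ _; exact: inner_content_ge0.
Qed.

Lemma outer_content_open U : open U -> outer_content U = inner_content U.
Proof.
move=> oU; apply/eqP; rewrite eq_le; apply/andP; split.
  by apply: ereal_inf_lbound; exists U => //; split.
by apply: le_ereal_inf_tmp => _ [V [_ UV] <-]; exact: le_inner_content.
Qed.

Lemma outer_content0 : outer_content set0 = 0%E.
Proof.
rewrite outer_content_open; last exact: open0.
apply/eqP; rewrite eq_le inner_content_ge0 andbT.
apply: ge_ereal_sup => _ [A [_ A0] <-].
by rewrite (_ : A = set0) ?content0//; apply/seteqP; split.
Qed.

Lemma outer_content_ge0 A : (0 <= outer_content A)%E.
Proof. by apply: le_ereal_inf_tmp => _ [V [_ UV] <-]; exact: inner_content_ge0. Qed.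

Lemma le_outer_content : {homo outer_content : A B / A `<=` B >-> (A <= B)%E}.
Proof.
move=> A B AB; apply: ereal_inf_le_tmp => _ [U [oU BU] <-].
by exists U => //; split=> //; exact: subset_trans BU.
Qed.

Lemma outer_content_le1 A : (outer_content A <= 1)%E.
Proof.
apply: (@le_trans _ _ (outer_content setT)); first exact: le_outer_content.
by rewrite outer_content_open ?inner_content_le1//; exact: openT.
Qed.

Lemma outer_content_fin A : outer_content A \is a fin_num.
Proof.
rewrite ge0_fin_numE ?outer_content_ge0//.
by rewrite (le_lt_trans (outer_content_le1 A))// ltry.
Qed.

Lemma outer_content_adherent A (e : R) : 0 < e ->
  exists U, [/\ open U, A `<=` U & (inner_content U < outer_content A + e%:E)%E].
Proof.
move=> e0; have [_ [U [oU AU] <-] lt] := lb_ereal_inf_adherent e0 (outer_content_fin A).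
by exists U.
Qed.

Lemma outer_content_sigma_subadditive : sigma_subadditive outer_content.
Proof.
move=> A.
suff add2e (e : {posnum R}) : (outer_content (\bigcup_n A n) <=
    \sum_(i <oo) outer_content (A i) + e%:num%:E)%E.
  by apply/lee_addgt0Pr => _/posnumP[].
rewrite (le_trans _ (epsilon_trick _ _ _))//; last first.
  by move=> n; exact: outer_content_ge0.
have [U PU] := choice (fun n : nat =>
  @outer_content_adherent (A n) (e%:num / (2 ^ n.+1)%:R) ltac:(by [])).
apply: (@le_trans _ _ (inner_content (\bigcup_n U n))).
  apply: ereal_inf_lbound; exists (\bigcup_n U n) => //; split.
    by apply: bigcup_open => n _; have [] := PU n.
  by apply: subset_bigcup => n _; have [] := PU n.
apply: le_trans (inner_content_bigcup _) _; first by move=> n; have [] := PU n.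
apply: lee_nneseries => n _; first by move=> _; exact: inner_content_ge0.
by have [_ _ /ltW] := PU n.
Qed.

HB.instance Definition _ := isOuterMeasure.Build R T outer_content
  outer_content0 outer_content_ge0 le_outer_content outer_content_sigma_subadditive.

Lemma inner_content_adherent U (e : R) : 0 < e ->
  exists K, [/\ closed K, K `<=` U & (inner_content U - e%:E < (nu K)%:E)%E].
Proof.
move=> e0.
have [_ [K [cK KU] <-] lt] := ub_ereal_sup_adherent e0 (inner_content_fin U).
by exists K.
Qed.

(** For an open [U] around the test set, take a nearly optimal closed [K] in [U] and [V], and only
    then a nearly optimal closed [L] in [U \ K]. Then [K] and [L] are disjoint, [nu] is additive on
    them, and [U \ K] still contains [U \ V]. *)
Lemma open_caratheodory V : open V -> outer_content.-caratheodory V.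
Proof.
move=> oV; apply: le_caratheodory_measurable => X /=.
apply: le_ereal_inf_tmp => _ [U [oU XU] <-].
apply: (@le_trans _ _ (inner_content (U `&` V) + outer_content (U `&` ~` V))%E).
  rewrite -outer_content_open; last exact: openI.
  by apply: leeD; apply: le_outer_content; exact: setSI.
apply/lee_addgt0Pr => e e0.
have e20 : 0 < e / 2 by rewrite divr_gt0.
have [K [cK KUV Ke]] := inner_content_adherent (U `&` V) e20.
have [L [cL LUK Le]] := inner_content_adherent (U `\` K) e20.
have UVUK : (outer_content (U `&` ~` V) <= inner_content (U `\` K))%E.
  rewrite -outer_content_open; last by rewrite setDE; apply: openI => //; exact: closed_openC.
  by apply: le_outer_content => x [Ux nVx]; split=> // /KUV[].
have KL : ((nu K + nu L)%:E <= inner_content U)%E.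
  rewrite -nuU; last first.
    by apply/seteqP; split=> // x [Kx /LUK[]].
  apply: inner_content_ge; first exact: closedU.
  by move=> x [/KUV[]//|/LUK[]].
move: Ke Le UVUK KL.
rewrite -(fineK (inner_content_fin U)) -(fineK (inner_content_fin (U `&` V))).
rewrite -(fineK (inner_content_fin (U `\` K))).
rewrite -(fineK (outer_content_fin (U `&` ~` V))).
rewrite -!EFinD -?EFinB !lte_fin !lee_fin; lra.
Qed.

Definition borel := g_sigma_algebraType (@open T).

Lemma borel_caratheodory (A : set borel) : measurable A ->
  outer_content.-caratheodory A.
Proof.
move: A; apply: smallest_sub => [|V]; last exact: open_caratheodory.
split=> [|A mA|F mF].
- exact: caratheodory_measurable_set0.
- by rewrite setTD; exact: caratheodory_measurable_setC.
- exact: caratheodory_measurable_bigcup.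
Qed.

Definition content_measure : set borel -> \bar R := outer_content.

Lemma content_measure_sigma_additive : semi_sigma_additive content_measure.
Proof.
move=> F mF tF mUF; apply: (@caratheodory_measure_sigma_additive _ _ outer_content) => //.
  by move=> n; exact: borel_caratheodory.
exact: borel_caratheodory.
Qed.

HB.instance Definition _ := isMeasure.Build _ borel R content_measure
  outer_content0 outer_content_ge0 content_measure_sigma_additive.

Lemma content_measure_setT : content_measure setT = 1%E.
Proof.
apply/eqP; rewrite eq_le outer_content_le1 /=.
rewrite /content_measure outer_content_open; last exact: openT.
by rewrite -nuT; apply: inner_content_ge; first exact: closedT.
Qed.

HB.instance Definition _ := Measure_isProbability.Build _ borel R
  content_measure content_measure_setT.

Lemma content_measure_outer (A : set borel) : content_measure A =
  ereal_inf [set content_measure U | U in [set U : set T | open U /\ A `<=` U]].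
Proof.
rewrite /content_measure {1}/outer_content; congr ereal_inf.
by apply: eq_imagel => U [oU _]; rewrite outer_content_open.
Qed.

(** This is outer regularity of the complement: the complement of an open set around [~] [A] is a
    compact subset of [A], and the total mass is 1. *)
Lemma content_measure_inner (A : set borel) : measurable A ->
  content_measure A =
  ereal_sup [set content_measure K | K in [set K : set T | compact K /\ K `<=` A]].
Proof.
move=> mA; apply/eqP; rewrite eq_le; apply/andP; split; last first.
  by apply: ge_ereal_sup => _ [K [_ KA] <-]; exact: le_outer_content.
apply/lee_addgt0Pr => e e0.
have [U [oU AU Ue]] := outer_content_adherent (~` A) e0.
have mU : measurable (U : set borel) by exact: sub_sigma_algebra.
have KA : ~` U `<=` A by rewrite -[A]setCK; exact: subsetC.
have cK : compact (~` U : set T).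
  by apply: subclosed_compact T_compact _ => //; exact: open_closedC.
apply: (@le_trans _ _ (content_measure (~` U) + e%:E)%E); last first.
  rewrite leeD2r//; apply: ereal_sup_ubound; exists (~` U) => //.
have fin B : content_measure B \is a fin_num by exact: outer_content_fin.
have fineC (B : set borel) : measurable B ->
    fine (content_measure (~` B)) = 1 - fine (content_measure B).
  by move=> mB; rewrite probability_setC// fineB.
move: Ue (fineC _ mA) (fineC _ mU); rewrite -outer_content_open//.
rewrite -/(content_measure U) -/(content_measure (~` A)).
rewrite -(fineK (fin A)) -(fineK (fin U)) -(fineK (fin (~` U))) -(fineK (fin (~` A))).
rewrite -!EFinD lte_fin lee_fin; lra.
Qed.

(** Every open set around [K] has [K] among its closed subsets. *)
Lemma content_measure_closed (K : set T) : closed K ->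
  ((nu K)%:E <= content_measure K)%E.
Proof.
by move=> cK; apply: le_ereal_inf_tmp => _ [U [oU KU] <-]; exact: inner_content_ge.
Qed.

Theorem content_regular_measure :
  exists eta : probability borel R,
  (forall A : set T, measurable (A : set borel) ->
    eta A = ereal_inf [set eta U | U in [set U : set T | open U /\ A `<=` U]] /\
    eta A = ereal_sup [set eta C | C in [set C : set T | compact C /\ C `<=` A]]) /\
  forall K : set T, closed K -> ((nu K)%:E <= eta K)%E.
Proof.
exists content_measure; split=> [A mA|]; last exact: content_measure_closed.
by split; [exact: content_measure_outer|exact: content_measure_inner].
Qed.

End RegularMeasure.

(** * The space of bounded functions *)

Section BoundedFunctions.
Context (R : realType) (T : Type).

Definition bounded_pred : {pred T -> R^o} :=
  fun f => `[< exists M : R, forall x, `|f x| <= M >].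

Lemma bounded_submod : submod_closed bounded_pred.
Proof.
split=> [|a f g /asboolP[M fM] /asboolP[N gN]]; apply/asboolP.
  by exists 0 => x; rewrite normr0.
exists (`|a| * M + N) => x; rewrite (le_trans (ler_normD _ _))//.
by rewrite lerD// normrM ler_wpM2l.
Qed.

HB.instance Definition _ :=
  GRing.isSubmodClosed.Build R (T -> R^o) bounded_pred bounded_submod.

Record bfun : Type := MkBfun {
  bfun_fun :> T -> R^o ;
  bfunP : bfun_fun \in bounded_pred
}.

HB.instance Definition _ := [isSub for bfun_fun].
HB.instance Definition _ := [Choice of bfun by <:].
HB.instance Definition _ := [SubChoice_isSubLmodule of bfun by <:].

Lemma bfun_bound (f : bfun) : exists M : R, forall x, `|f x| <= M.
Proof. by have /asboolP := bfunP f. Qed.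

Lemma bfunD (f g : bfun) x : (f + g) x = f x + g x. Proof. by []. Qed.

Lemma bfunZ (a : R) (f : bfun) x : (a *: f) x = a * f x. Proof. by []. Qed.

Lemma bfunN (f : bfun) x : (- f) x = - f x. Proof. by []. Qed.

Lemma bfun0 x : (0 : bfun) x = 0. Proof. by []. Qed.

Lemma bfun_sum I (s : seq I) (P : pred I) (f : I -> bfun) x :
  (\sum_(i <- s | P i) f i) x = \sum_(i <- s | P i) f i x.
Proof. by elim/big_rec2 : _ => // i y z Pi <-. Qed.

Lemma indic_bounded (A : set T) : (\1_A : T -> R^o) \in bounded_pred.
Proof.
apply/asboolP; exists 1 => x; rewrite /indic; case: (_ \in _) => /=.
  by rewrite normr1.
by rewrite normr0.
Qed.

Definition bindic (A : set T) : bfun := MkBfun (indic_bounded A).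

End BoundedFunctions.

(** The hypothesis is upper semicontinuity; the rays [[c, +oo[] generate the Borel sets of the
    line. *)
Lemma closed_superlevel_measurable (R : realType) (T : ptopologicalType)
    (f : T -> R) : (forall c, closed [set x | c <= f x]) ->
  measurable_fun setT (f : g_sigma_algebraType (@open T) -> R).
Proof.
move=> fclosed; apply: (measurability _ (RGenCInfty.measurableE R)).
move=> _ [_ [c ->] <-]; rewrite setTI -[X in measurable X]setCK.
apply: measurableC; apply: sub_sigma_algebra; apply: closed_openC.
suff -> : f @^-1` [set` `[c, +oo[] = [set x | c <= f x] by exact: fclosed.
by apply/seteqP; split=> x /=; rewrite in_itv /= andbT.
Qed.

(** * From positive functionals to measures *)

Section PositiveFunctional.
Context (R : realType) (T : ptopologicalType).
Hypotheses (T_compact : compact [set: T]) (T_hausdorff : hausdorff_space T).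
Variable L : bfun R T -> R.
Hypotheses (L_linear : forall (a : R) f g, L (a *: f + g) = a * L f + L g)
  (L_le : forall f g : bfun R T, (forall x, f x <= g x) -> L f <= L g)
  (L1 : L (bindic R setT) = 1).

Let nu (A : set T) : R := L (bindic R A).

Let nu_ge0 A : 0 <= nu A.
Proof.
rewrite -(linear_functional0 L_linear); apply: L_le => x.
by rewrite bfun0 /= indicE ler0n.
Qed.

Let nuU A B : A `&` B = set0 -> nu (A `|` B) = nu A + nu B.
Proof.
move=> AB; rewrite /nu -(linear_functionalD L_linear); congr L; apply/val_inj/funext => x.
rewrite -[RHS]/(\1_A x + \1_B x) /= !indicE in_setU; case xA: (x \in A); case xB: (x \in B);
  rewrite /= ?addr0 ?add0r//.
by move: (in_set0 x); rewrite -AB in_setI xA xB.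
Qed.

(** The discrete layer-cake sum: for [e > 0] and [f x >= 0] it is the largest multiple of [e] below
    [f x], capped at [n e]. *)
Let layers (f : T -> R) (e : R) n (x : T) : R :=
  e * \sum_(j < n) \1_[set y | j.+1%:R * e <= f y] x.

Let layers_le f e n x : 0 <= e -> 0 <= f x -> layers f e n x <= f x.
Proof.
move=> e0 fx0; rewrite /layers; elim: n => [|n IH].
  by rewrite big_ord0 mulr0.
have [le_n|lt_n] := leP (n.+1%:R * e) (f x).
  apply: le_trans le_n; rewrite mulrC ler_wpM2r//.
  rewrite -[leRHS]mulr1 mulr_natl -[X in _ *+ X]card_ord -sumr_const.
  by apply: ler_sum => i _; rewrite indicE lern1 leq_b1.
rewrite big_ord_recr /= [X in _ + X]indicE memNset ?addr0//=.
by apply/negP; rewrite -ltNge.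
Qed.

(** With an error of [e] allowed, [n] layers reach functions bounded by [(n + 1) e]. *)
Let layers_ge f e n x : 0 <= e -> f x <= n.+1%:R * e ->
  f x <= e + layers f e n x.
Proof.
move=> e0; rewrite /layers; elim: n => [|n IH] fx.
  by rewrite big_ord0 mulr0 addr0 -[e]mul1r.
have [le_n|lt_n] := leP (n.+1%:R * e) (f x).
  apply: (le_trans fx); rewrite -natr1 mulrDl mul1r addrC lerD2l mulrC.
  rewrite ler_wpM2l// -[leLHS]mulr1 mulr_natl -[X in _ *+ X]card_ord -sumr_const.
  apply: ler_sum => i _; rewrite indicE mem_set//=.
  by apply: le_trans le_n; rewrite ler_wpM2r// ler_nat ltn_ord.
apply: (le_trans (IH (ltW lt_n))).
by rewrite lerD2l ler_wpM2l// big_ord_recr /= lerDl indicE ler0n.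
Qed.

(** The layers are indicators of closed superlevel sets, where [nu <= eta]. They start at height
    [e], so closedness is only asked at positive levels; level 0 gives the whole space. *)
Theorem positive_functional_measure :
  exists eta : probability (g_sigma_algebraType (@open T)) R,
  (forall A : set T, measurable (A : set (g_sigma_algebraType (@open T))) ->
    eta A = ereal_inf [set eta U | U in [set U : set T | open U /\ A `<=` U]] /\
    eta A = ereal_sup [set eta C | C in [set C : set T | compact C /\ C `<=` A]]) /\
  forall f : bfun R T, (forall c : R, 0 < c -> closed [set x | c <= f x]) ->
    (forall x, 0 <= f x) -> ((L f)%:E <= \int[eta]_x (f x)%:E)%E.
Proof.
have nuT : nu setT = 1 by [].
have [eta [eta_reg eta_closed]] :=
  content_regular_measure T_compact T_hausdorff nu_ge0 nuU nuT.
exists eta; split=> // f fclosed f0; apply/lee_addgt0Pr => e e0.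
have e0' := ltW e0.
have [M fM] := bfun_bound f.
have M0 : 0 <= M by apply: le_trans (fM point).
pose n := Num.bound (M / e).
have fn x : f x <= n.+1%:R * e.
  apply: (le_trans (ler_norm _)); apply: (le_trans (fM x)).
  rewrite -ler_pdivrMr//; apply/ltW/(lt_le_trans (archi_boundP _)).
    by rewrite divr_ge0.
  by rewrite ler_nat.
pose K (j : 'I_n) : set T := [set y | j.+1%:R * e <= f y].
have cK j : closed (K j).
  by apply: fclosed; rewrite mulr_gt0.
have mK j : measurable (K j : set (g_sigma_algebraType (@open T))).
  rewrite -[K j]setCK; apply: measurableC; apply: sub_sigma_algebra.
  exact: closed_openC.
(* The error [e] is rewritten as [e] times [L] of the constant 1, so that [layers_ge] compares two
   bounded functions and monotonicity of [L] applies. *)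
have lef : L f <= e + e * \sum_j nu (K j).
  rewrite -(linear_functional_sum L_linear) -(linear_functionalZ L_linear) -[X in X + _]mulr1.
  rewrite -L1 -(linear_functionalZ L_linear) -(linear_functionalD L_linear); apply: L_le => x.
  rewrite bfunD !bfunZ bfun_sum /= indicE mem_set// mulr1.
  exact: layers_ge.
apply: (@le_trans _ _ (e + e * \sum_j nu (K j))%:E); first by rewrite lee_fin.
rewrite addrC EFinD leeD2r//.
apply: (@le_trans _ _ (\int[eta]_x (layers f e n x)%:E)%E); last first.
  apply: ge0_le_integral => //.
  - move=> x _; rewrite lee_fin mulr_ge0//; apply: sumr_ge0 => i _.
    by rewrite indicE.
  - apply/measurable_EFinP/measurable_funM => //.
    by apply: measurable_sum => j; apply: measurable_indic; exact: mK.
  - apply/measurable_EFinP; apply: closed_superlevel_measurable => c.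
    have [c0|] := leP c 0; last exact: fclosed.
    rewrite (_ : mkset _ = setT); first exact: closedT.
    by apply/seteqP; split=> // x _; exact: le_trans (f0 x).
  - by move=> x _; rewrite lee_fin; exact: layers_le.
under eq_integral => x _ do rewrite EFinM -sumEFin.
have mindic j :
    measurable_fun setT (fun x : g_sigma_algebraType (@open T) =>
      (\1_(K j) x : R)%:E).
  by apply/measurable_EFinP/measurable_indic; exact: mK.
rewrite ge0_integralZl//; last 2 first.
- exact: emeasurable_sum.
- by move=> x _; apply: sume_ge0 => j _; rewrite lee_fin indicE.
rewrite ge0_integral_sum//.
rewrite EFinM -sumEFin lee_pmul2l// ?lte_fin//.
apply: lee_sum => j _.
rewrite integral_indic//; last exact: mK.
by rewrite setIT; exact: eta_closed.
Qed.

End PositiveFunctional.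

(** * Completion of a seminormed space *)

Definition seq_cauchy (R : realType) (V : zmodType) (N : V -> R) (u : nat -> V) :=
  forall e : R, 0 < e -> exists n0, forall n m, (n0 <= n)%N -> (n0 <= m)%N ->
    N (u n - u m) < e.

Section RnormCauchy.
Context (R : realType) (k : scalar_kind).
Local Notation K := (scalars R k).

Lemma rnorm_cauchy_cvg (W : completeNormedModType K) (w : nat -> W) :
  seq_cauchy (@rnorm R k W) w ->
  exists l : W, forall e : R, 0 < e ->
    exists n0, forall n, (n0 <= n)%N -> rnorm (w n - l) < e.
Proof.
move=> cw; have /cauchy_cvg/cvg_ex[l wl] : cauchy (w @ \oo).
  apply: cauchy_exP => e e0.
  have e0' : 0 < to_real e.
    by rewrite -(@lt_of_real R k) of_real0 -ge0_of_real// ltW.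
  have [n0 wn0] := cw _ e0'; exists (w n0), n0 => // n /= n0n.
  rewrite /= -ball_normE /ball_ /= norm_of_real [ltRHS]ge0_of_real ?ltW//.
  by rewrite lt_of_real; exact: wn0.
exists l => e e0; move/cvg_rnorm : wl => /(_ e e0)[n0 _ wn0].
by exists n0.
Qed.

Lemma rnorm_lt_eq (W : normedZmodType K) (v w : W) :
  (forall e : R, 0 < e -> rnorm (v - w) < e) -> v = w.
Proof.
move=> vw; apply/eqP; rewrite -subr_eq0; apply/eqP/rnorm_eq0/eqP.
rewrite eq_le rnorm_ge0 andbT; apply/ler_addgt0Pr => e e0.
by rewrite add0r ltW// vw.
Qed.

End RnormCauchy.

Section Completion.
Context (R : realType) (k : scalar_kind).
Local Notation K := (scalars R k).
Context (V : lmodType K) (N : V -> R).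
Hypothesis N_seminorm : seminorm N.

Let N_ge0 v : 0 <= N v. Proof. by case: N_seminorm. Qed.
Let ND v w : N (v + w) <= N v + N w. Proof. by case: N_seminorm => _ []. Qed.
Let NZ (a : K) v : N (a *: v) = rnorm a * N v. Proof. by case: N_seminorm => _ []. Qed.

Lemma seminorm0 : N 0 = 0.
Proof. by rewrite -(scale0r 0) NZ rnorm0 mul0r. Qed.

Lemma seminormN v : N (- v) = N v.
Proof. by rewrite -scaleN1r NZ rnormN -(of_real1 R k) rnorm_of_real normr1 mul1r. Qed.

Lemma seminormB v w : N (v - w) = N (w - v).
Proof. by rewrite -seminormN opprB. Qed.

Lemma seminorm_dist v w : `|N v - N w| <= N (v - w).
Proof.
rewrite ler_norml; apply/andP; split.
  have := ND (w - v) v; rewrite subrK seminormB; lra.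
have := ND (v - w) w; rewrite subrK; lra.
Qed.

Definition cauchy_pred : {pred nat -> V} := fun u => `[< seq_cauchy N u >].

Lemma cauchy_submod : submod_closed cauchy_pred.
Proof.
split=> [|a u v /asboolP cu /asboolP cv]; apply/asboolP => e e0.
  by exists 0%N => n m _ _; rewrite subrr seminorm0.
have a0 : 0 < rnorm a + 1 by rewrite ltr_wpDl ?rnorm_ge0.
have [n0 un0] := cu (e / 2 / (rnorm a + 1)) ltac:(by rewrite !divr_gt0).
have [n1 vn1] := cv (e / 2) ltac:(by rewrite divr_gt0).
exists (maxn n0 n1) => n m; rewrite !geq_max => /andP[n0n n1n] /andP[n0m n1m].
rewrite -[X in N X]/(a *: u n + v n - (a *: u m + v m)) opprD addrACA -scalerBr.
apply: (le_lt_trans (ND _ _)); rewrite [ltRHS]splitr NZ.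
apply: ler_ltD; last exact: vn1.
apply: (@le_trans _ _ ((rnorm a + 1) * N (u n - u m))).
  by rewrite ler_wpM2r// lerDl.
by rewrite mulrC -ler_pdivlMr//; apply/ltW/un0.
Qed.

HB.instance Definition _ :=
  GRing.isSubmodClosed.Build K (nat -> V) cauchy_pred cauchy_submod.

(** The completion consists of sequences that are Cauchy for [N], modulo those along which [N] tends
    to 0; this divides out the kernel of [N] at the same time. *)
Record cseq : Type := MkCseq {
  cseq_fun :> nat -> V ;
  cseqP : cseq_fun \in cauchy_pred
}.

HB.instance Definition _ := [isSub for cseq_fun].
HB.instance Definition _ := [Choice of cseq by <:].
HB.instance Definition _ := [SubChoice_isSubLmodule of cseq by <:].

Lemma cseq_cauchy (u : cseq) : seq_cauchy N u.
Proof. by have /asboolP := cseqP u. Qed.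

Lemma cseq_cvg (u : cseq) : exists l : R, forall e : R, 0 < e ->
  exists n0, forall n, (n0 <= n)%N -> `|N (u n) - l| < e.
Proof.
have /cauchy_cvg/cvg_ex[l ul] : cauchy ((N \o u) @ \oo).
  apply: cauchy_exP => e e0; have [n0 un0] := cseq_cauchy u e0.
  exists (N (u n0)), n0 => // n /= n0n.
  rewrite -ball_normE /ball_ /=; apply: le_lt_trans (un0 _ _ (leqnn n0) n0n).
  exact: seminorm_dist.
exists l => e e0; move/cvgrPdist_lt : ul => /(_ e e0)[n0 _ un0].
by exists n0 => n n0n; rewrite distrC; exact: un0.
Qed.

(** The default 0 is never taken: the seminorms along a Cauchy sequence converge in [R], see
    [cseq_cvg]. *)
Definition clim (u : cseq) : R := xget 0 [set l : R | forall e : R, 0 < e ->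
  exists n0, forall n, (n0 <= n)%N -> `|N (u n) - l| < e].

Lemma climP (u : cseq) e : 0 < e ->
  exists n0, forall n, (n0 <= n)%N -> `|N (u n) - clim u| < e.
Proof.
rewrite /clim; case: xgetP => [l _|nlim]; first exact.
by have [l ul] := cseq_cvg u; have := nlim l.
Qed.

Lemma clim_le (u : cseq) c n0 :
  (forall n, (n0 <= n)%N -> N (u n) <= c) -> clim u <= c.
Proof.
move=> uc; apply/ler_addgt0Pr => e e0; have [n1 un1] := climP u e0.
have := un1 _ (leq_maxr n0 n1); have := uc _ (leq_maxl n0 n1).
by rewrite ltr_norml => + /andP[]; lra.
Qed.

Lemma clim_ge0 u : 0 <= clim u.
Proof.
apply/ler_addgt0Pr => e e0; have [n1 un1] := climP u e0.
have := un1 _ (leqnn n1); rewrite ltr_norml => /andP[].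
by have := N_ge0 (u n1); lra.
Qed.

Lemma climD u v : clim (u + v) <= clim u + clim v.
Proof.
apply/ler_addgt0Pr => e e0.
have e20 : 0 < e / 2 by rewrite divr_gt0.
have [n0 un0] := climP u e20; have [n1 vn1] := climP v e20.
apply: (@clim_le _ _ (maxn n0 n1)) => n; rewrite geq_max => /andP[n0n n1n].
apply: le_trans (ND _ _) _.
by have := un0 n n0n; have := vn1 n n1n; rewrite !ltr_norml => /andP[? ?] /andP[? ?]; lra.
Qed.

Lemma climZ_le a u : clim (a *: u) <= rnorm a * clim u.
Proof.
apply/ler_addgt0Pr => e e0.
have a0 : 0 < rnorm a + 1 by rewrite ltr_wpDl ?rnorm_ge0.
have [n0 un0] := climP u (divr_gt0 e0 a0).
apply: (@clim_le _ _ n0) => n n0n; rewrite NZ.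
have := un0 n n0n; rewrite ltr_norml => /andP[_ un].
rewrite -lerBlDl -mulrBr; apply: (@le_trans _ _ (rnorm a * (e / (rnorm a + 1)))).
  by rewrite ler_wpM2l ?rnorm_ge0// ltW.
rewrite mulrCA ler_piMr ?(ltW e0)// ler_pdivrMr// mul1r lerDl.
exact: ler01.
Qed.

(** The missing inequality is [climZ_le] for the inverse scalar, applied to [a *: u]. *)
Lemma climZ a u : clim (a *: u) = rnorm a * clim u.
Proof.
apply/eqP; rewrite eq_le climZ_le /=.
have [->|a0] := eqVneq a 0; first by rewrite rnorm0 mul0r clim_ge0.
have ra0 : 0 < rnorm a.
  by rewrite lt_neqAle rnorm_ge0 andbT eq_sym; apply: contra_neq a0; exact: rnorm_eq0.
have := climZ_le a^-1 (a *: u); rewrite scalerA mulVf// scale1r => ule.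
have rV : rnorm a * rnorm a^-1 = 1.
  by rewrite -rnormM divff// -(of_real1 R k) rnorm_of_real normr1.
apply: (@le_trans _ _ (rnorm a * (rnorm a^-1 * clim (a *: u)))).
  by rewrite ler_wpM2l// ltW.
by rewrite mulrA rV mul1r.
Qed.

Lemma clim0 : clim 0 = 0.
Proof. by rewrite -(scale0r 0) climZ rnorm0 mul0r. Qed.

Lemma climN u : clim (- u) = clim u.
Proof. by rewrite -scaleN1r climZ rnormN -(of_real1 R k) rnorm_of_real normr1 mul1r. Qed.

Definition null_pred : {pred cseq} := fun u => clim u == 0.

Lemma null_zmod : zmod_closed null_pred.
Proof.
split=> [|u v /eqP u0 /eqP v0]; first exact/eqP/clim0.
apply/eqP/le_anti; rewrite clim_ge0 andbT.
by apply: le_trans (climD _ _) _; rewrite climN u0 v0 addr0.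
Qed.

HB.instance Definition _ := GRing.isZmodClosed.Build cseq null_pred null_zmod.

(** A quotient of additive groups; the scalar action is put back through representatives by
    [cscale], which [cpiZ_eq] shows to be independent of them. *)
Definition cquot := Quotient.quot null_pred.

HB.instance Definition _ := GRing.Zmodule.on cquot.

Definition cpi (u : cseq) : cquot := (\pi_cquot u)%qT.

Lemma cpiD u v : cpi (u + v) = cpi u + cpi v.
Proof. exact: raddfD. Qed.

Lemma cpi_repr (x : cquot) : cpi (repr x) = x.
Proof. exact: reprK. Qed.

Lemma cpi_eq u v : (cpi u == cpi v) = (clim (u - v) == 0).
Proof. by rewrite -[RHS]/((u - v) \in null_pred) Quotient.idealrBE. Qed.

Lemma cpiZ_eq (a : K) u v : cpi u = cpi v -> cpi (a *: u) = cpi (a *: v).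
Proof.
move=> /eqP; rewrite cpi_eq => /eqP uv; apply/eqP; rewrite cpi_eq.
by rewrite -scalerBr climZ uv mulr0.
Qed.

Definition cscale (a : K) (x : cquot) : cquot := cpi (a *: repr x).

Lemma cscale_pi a u : cscale a (cpi u) = cpi (a *: u).
Proof. by apply: cpiZ_eq; rewrite cpi_repr. Qed.

Fact cscaleA a b x : cscale a (cscale b x) = cscale (a * b) x.
Proof. by rewrite -(cpi_repr x) !cscale_pi scalerA. Qed.

Fact cscale1 : left_id 1 cscale.
Proof. by move=> x; rewrite -(cpi_repr x) cscale_pi scale1r. Qed.

Fact cscaleDr : right_distributive cscale +%R.
Proof.
move=> a x y; rewrite -(cpi_repr x) -(cpi_repr y) -cpiD !cscale_pi -cpiD.
by rewrite scalerDr.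
Qed.

Fact cscaleDl x : {morph cscale^~ x : a b / a + b}.
Proof. by move=> a b; rewrite -(cpi_repr x) !cscale_pi -cpiD scalerDl. Qed.

HB.instance Definition _ :=
  GRing.Zmodule_isLmodule.Build K cquot cscaleA cscale1 cscaleDr cscaleDl.

Lemma cscaleE (a : K) (x : cquot) : a *: x = cscale a x. Proof. by []. Qed.

Definition cnorm (x : cquot) : R := clim (repr x).

Lemma cnorm_pi u : cnorm (cpi u) = clim u.
Proof.
have /eqP : cpi (repr (cpi u)) = cpi u by exact: cpi_repr.
rewrite cpi_eq /cnorm; set v := repr _ => /eqP uv.
have vu : clim (u - v) = 0 by rewrite -opprB climN.
apply/le_anti; apply/andP; split.
  by rewrite -[v](subrK u); apply: le_trans (climD _ _) _; rewrite uv add0r.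
by rewrite -[X in clim X <= _](subrK v); apply: le_trans (climD _ _) _; rewrite vu add0r.
Qed.

Fact cnormD x y :
  of_real k (cnorm (x + y)) <= of_real k (cnorm x) + of_real k (cnorm y).
Proof.
rewrite -of_realD le_of_real -(cpi_repr x) -(cpi_repr y) -cpiD !cnorm_pi.
exact: climD.
Qed.

Fact cnormZ (a : K) x : of_real k (cnorm (a *: x)) = `|a| * of_real k (cnorm x).
Proof.
rewrite norm_of_real -of_realM -(cpi_repr x); congr of_real.
by rewrite -[_ *: _]/(cscale _ _) cscale_pi !cnorm_pi climZ.
Qed.

Fact cnorm0_eq0 x : of_real k (cnorm x) = 0 -> x = 0.
Proof.
move/(congr1 (@to_real R k)); rewrite of_realK -{1}(of_real0 R k) of_realK.
rewrite -(cpi_repr x) cnorm_pi => x0.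
have -> : 0 = cpi 0 by rewrite -[LHS](raddf0 (\pi_cquot)%qT).
by apply/eqP; rewrite cpi_eq subr0 x0.
Qed.

HB.instance Definition _ := Lmodule_isNormed.Build K cquot cnormD cnormZ cnorm0_eq0.

Lemma rnorm_cquot (x : cquot) : rnorm x = cnorm x.
Proof. exact: of_realK. Qed.

Lemma cst_cauchy v : (fun=> v) \in cauchy_pred.
Proof. by apply/asboolP => e e0; exists 0%N => n m _ _; rewrite subrr seminorm0. Qed.

Definition cembed (v : V) : cquot := cpi (MkCseq (cst_cauchy v)).

Fact cembed_linear : linear cembed.
Proof.
move=> a u v; rewrite /cembed cscaleE cscale_pi -cpiD.
by congr cpi; exact/val_inj.
Qed.

HB.instance Definition _ := GRing.isLinear.Build K V cquot *:%R cembed cembed_linear.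

Lemma rnorm_cembed v : rnorm (cembed v) = N v.
Proof.
rewrite rnorm_cquot cnorm_pi; apply/eqP; rewrite -subr_eq0 -normr_le0.
apply/ler_addgt0Pr => e e0; rewrite add0r.
have [n un] := climP (MkCseq (cst_cauchy v)) e0.
by have := un n (leqnn n); rewrite /= distrC => /ltW.
Qed.

Lemma cembed_cvg (u : cseq) (e : R) : 0 < e ->
  exists n0, forall n, (n0 <= n)%N -> rnorm (cpi u - cembed (u n)) < e.
Proof.
move=> e0; have e20 : 0 < e / 2 by rewrite divr_gt0.
have [n0 un0] := cseq_cauchy u e20; exists n0 => n n0n.
have -> : cpi u - cembed (u n) = cpi (u - MkCseq (cst_cauchy (u n))).
  by rewrite cpiD -scaleN1r -[- _ as X in cpi X]scaleN1r -cscale_pi.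
rewrite rnorm_cquot cnorm_pi; apply: (@le_lt_trans _ _ (e / 2)).
  by apply: (@clim_le _ _ n0) => m n0m; exact/ltW/un0.
by rewrite gtr_pMr// invf_lt1// ltr1n.
Qed.

Lemma cembed_dense (z : cquot) (e : R) : 0 < e -> exists v, rnorm (z - cembed v) < e.
Proof.
move=> e0; have [n0 un0] := cembed_cvg (repr z) e0; exists (repr z n0).
by have := un0 _ (leqnn n0); rewrite cpi_repr.
Qed.

(** A Cauchy filter is followed by vectors of [V] whose images come ever closer to it. Any two
    filter sets meet, so these vectors form a Cauchy sequence, and its class is the limit. *)
Lemma cquot_complete (F : set_system cquot) : ProperFilter F -> cauchy F -> cvg F.
Proof.
move=> FF /cauchyP Fc.
(* Of the factor 2, one half is the radius of the filter ball, the other the error in approximating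
   its centre from [V]. *)
have Fv (n : nat) : exists v, F [set y | rnorm (y - cembed v) < 2 * n.+1%:R^-1].
  have n0 : 0 < n.+1%:R^-1 :> R by rewrite invr_gt0.
  have [|x Fx] := Fc (of_real k n.+1%:R^-1); first by rewrite -(of_real0 R k) lt_of_real.
  have [v xv] := cembed_dense x n0; exists v.
  apply: filterS Fx => y; rewrite -ball_normE /ball_ /= norm_of_real lt_of_real => xy.
  rewrite -[y - _](subrKA x); apply: le_lt_trans (rnormD _ _) _.
  by rewrite rnormB mulr2n mulrDl mul1r ltrD.
have [v Pv] := choice Fv.
have invn (e : R) : 0 < e -> exists n0 : nat, forall n, (n0 <= n)%N -> 2 * n.+1%:R^-1 < e.
  move=> e0; exists (Num.bound (2 / e)) => n n0n.
  rewrite ltr_pdivrMr// -ltr_pdivrMl// mulrC.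
  apply: lt_le_trans (archi_boundP _) _; first by rewrite divr_ge0 ?ltW.
  by rewrite ler_nat leqW.
have cv : v \in cauchy_pred.
  apply/asboolP => e e0; have e20 : 0 < e / 2 by rewrite divr_gt0.
  have [n0 n0e] := invn _ e20; exists n0 => n m n0n n0m.
  have [y [/= yn ym]] := filter_ex (filterI (Pv n) (Pv m)).
  rewrite -rnorm_cembed raddfB -[_ - _](subrKA y) [ltRHS]splitr.
  apply: le_lt_trans (rnormD _ _) _; rewrite rnormB ltrD//.
    exact: lt_trans yn (n0e _ n0n).
  exact: lt_trans ym (n0e _ n0m).
apply/cvg_ex; exists (cpi (MkCseq cv)) => A /nbhs_rnorm[e e0 eA].
have e20 : 0 < e / 2 by rewrite divr_gt0.
have [n0 n0e] := invn _ e20; have [n1 n1e] := cembed_cvg (MkCseq cv) e20.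
pose n := maxn n0 n1.
apply: filterS (Pv n) => y /= yn; apply: eA.
rewrite -[y - _](subrKA (cembed (v n))) [ltRHS]splitr.
apply: le_lt_trans (rnormD _ _) _; rewrite ltrD//.
  by apply: lt_trans yn (n0e _ _); rewrite leq_maxl.
by rewrite rnormB; apply: n1e; rewrite leq_maxr.
Qed.

HB.instance Definition _ := Uniform_isComplete.Build cquot cquot_complete.

Lemma cembed_dense_range : dense (range cembed).
Proof.
move=> O [z Oz] oO; have /nbhs_rnorm[e e0 eO] : nbhs z O by apply: open_nbhs_nbhs.
have [v zv] := cembed_dense z e0; exists (cembed v); split; last by exists v.
by apply: eO; rewrite rnormB.
Qed.

Theorem seminorm_completion : inhabited (completion N).
Proof.
constructor; exact: (@Completion R k V N cquot cembed rnorm_cembed cembed_dense_range).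
Qed.

End Completion.

(** * Extension of bounded operators to the completion *)

Section ContinuousExtension.
Context (R : realType) (k : scalar_kind).
Local Notation K := (scalars R k).
Context (V : lmodType K) (N : V -> R) (D : completion N).
Context (Y : completeNormedModType K) (S : {linear V -> Y}) (C : R).
Hypotheses (C_ge0 : 0 <= C) (S_le : forall v, rnorm (S v) <= C * N v).

Let q : {linear V -> D} := quotient_map D.

Let rnorm_q v : rnorm (q v) = N v. Proof. exact: norm_quotient_map. Qed.

(** [C] may be 0, so radii are divided by [C + 1]. *)
Let C1 : 0 < C + 1. Proof. by rewrite ltr_wpDl. Qed.

Let S_le_q v w : rnorm (S v - S w) <= C * rnorm (q v - q w).
Proof. by rewrite -!raddfB rnorm_q; exact: S_le. Qed.

Let q_dense (z : D) (e : R) : 0 < e -> exists v, rnorm (q v - z) < e.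
Proof.
move=> e0; have O0 : [set y : D | rnorm (y - z) < e] !=set0.
  by exists z; rewrite /= subrr rnorm0.
have oO : open [set y : D | rnorm (y - z) < e].
  rewrite openE => y /= yz; apply/nbhs_rnorm; exists (e - rnorm (y - z)).
    by rewrite subr_gt0.
  move=> x xy; rewrite /= -[x - z](subrKA y).
  by apply: le_lt_trans (rnormD _ _) _; rewrite -ltrBrDr.
by have [z' [/= z'z [v _ vE]]] := dense_quotient_map O0 oO; exists v; rewrite /q vE.
Qed.

(** Membership of [(z, y)] in the closure of the graph that sends [q v] to [S v]. *)
Let extends (z : D) (y : Y) := forall e : R, 0 < e ->
  exists2 v, rnorm (q v - z) < e & rnorm (S v - y) < e.

(** One estimate serves twice: with [z = z'] it makes the extension single-valued, and in general it
    makes it Lipschitz. *)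
Let extends_dist z z' y y' : extends z y -> extends z' y' ->
  rnorm (y - y') <= C * rnorm (z - z').
Proof.
move=> zy zy'; apply/ler_addgt0Pr => e e0.
(* The radius is such that two errors in [Y] and [C] times two errors in [D] add up to exactly
   [e]. *)
have e1 : 0 < e / (2 * (C + 1)) by rewrite divr_gt0// mulr_gt0.
set d := e / _ in e1.
have [v vz vy] := zy _ e1; have [v' vz' vy'] := zy' _ e1.
have -> : e = d + d + C * (d + d).
  have : e = d * (2 * (C + 1)) by rewrite /d mulfVK// mulf_neq0 ?gt_eqF.
  by move=> {1}->; ring.
have /(ler_wpM2l C_ge0) h : rnorm (q v - q v') <= rnorm (z - z') + (d + d).
  rewrite -(subrKA z (q v)) -(subrKA z' z (- q v')).
  apply: le_trans (rnormD _ _) _.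
  have := rnormD (z - z') (z' - q v').
  by rewrite (rnormB z' (q v')); lra.
have := S_le_q v v'.
have -> : y - y' = (y - S v) + ((S v - S v') + (S v' - y')) by rewrite !subrKA.
have := rnormD (y - S v) ((S v - S v') + (S v' - y')).
have := rnormD (S v - S v') (S v' - y').
rewrite (rnormB y (S v)) mulrDr in h *; lra.
Qed.

(** If [q (v n)] tends to [z], the bound on [S] makes [S (v n)] a Cauchy sequence, and [Y] is
    complete. *)
Let extends_ex z : exists y, extends z y.
Proof.
have /choice[v vz] (n : nat) : exists v, rnorm (q v - z) < n.+1%:R^-1.
  by apply: q_dense; rewrite invr_gt0.
have invn (e : R) : 0 < e -> exists n0 : nat, forall n, (n0 <= n)%N -> n.+1%:R^-1 < e.
  move=> e0; exists (Num.bound e^-1) => n n0n.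
  rewrite -[e]invrK ltf_pV2 ?posrE ?invr_gt0//.
  apply: lt_le_trans (archi_boundP _) _; first by rewrite invr_ge0 ltW.
  by rewrite ler_nat leqW.
have [|y Sy] := @rnorm_cauchy_cvg R k Y (S \o v).
  move=> e e0; have e1 : 0 < e / (2 * (C + 1)) by rewrite divr_gt0// mulr_gt0.
  have [n0 n0e] := invn _ e1; exists n0 => n m n0n n0m /=.
  apply: (@le_lt_trans _ _ ((C + 1) * rnorm (q (v n) - q (v m)))).
    by apply: le_trans (S_le_q _ _) _; rewrite ler_wpM2r ?rnorm_ge0// lerDl.
  rewrite -ltr_pdivlMl//.
  have -> : (C + 1)^-1 * e = e / (2 * (C + 1)) + e / (2 * (C + 1)).
    by field; rewrite gt_eqF.
  rewrite -(subrKA z (q (v n))); apply: le_lt_trans (rnormD _ _) _.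
  by rewrite (rnormB z) ltrD//; [apply: lt_trans (vz n) _|apply: lt_trans (vz m) _];
    exact: n0e.
exists y => e e0; have [n0 n0e] := invn _ e0; have [n1 n1e] := Sy _ e0.
exists (v (maxn n0 n1)); last by apply: n1e; rewrite leq_maxr.
by apply: lt_trans (vz _) (n0e _ _); rewrite leq_maxl.
Qed.

Let ext (z : D) : Y := sval (cid (extends_ex z)).

Let extP z : extends z (ext z). Proof. exact: svalP. Qed.

Let ext_eq z y : extends z y -> ext z = y.
Proof.
move=> zy; apply: rnorm_lt_eq => e e0.
by apply: le_lt_trans (extends_dist (extP z) zy) _; rewrite subrr rnorm0 mulr0.
Qed.

Let ext_linear : linear ext.
Proof.
move=> a z z'; apply: ext_eq => e e0.
have a0 : 0 < rnorm a + 1 by rewrite ltr_wpDl ?rnorm_ge0.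
have d0 : 0 < e / (rnorm a + 1) / 2 by rewrite !divr_gt0.
set d := _ / 2 in d0.
have e20 : 0 < e / 2 by rewrite divr_gt0.
have [v vz vy] := extP z d0; have [v' vz' vy'] := extP z' e20.
have ad (W : normedModType K) (s t u w : W) : rnorm (s - t) < d -> rnorm (u - w) < e / 2 ->
    rnorm (a *: s + u - (a *: t + w)) < e.
  move=> st uw; rewrite opprD addrACA -scalerBr [ltRHS]splitr.
  apply: le_lt_trans (rnormD _ _) _; apply: ler_ltD => //; rewrite rnormZ.
  have -> : e / 2 = (rnorm a + 1) * d by rewrite /d; field; rewrite gt_eqF.
  apply: ler_pM; rewrite ?rnorm_ge0//; first by rewrite lerDl.
  exact: ltW.
by exists (a *: v + v'); rewrite linearP; exact: ad.
Qed.

HB.instance Definition _ := GRing.isLinear.Build K D Y *:%R ext ext_linear.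

Theorem extend_to_completion : exists That : {linear D -> Y},
  continuous That /\ forall v, That (quotient_map D v) = S v.
Proof.
exists ext; split=> [z|v].
  apply/cvg_rnorm => e e0; apply/nbhs_rnorm; exists (e / (C + 1)).
    by rewrite divr_gt0.
  move=> y yz; apply: le_lt_trans (extends_dist (extP y) (extP z)) _.
  apply: (@le_lt_trans _ _ ((C + 1) * rnorm (y - z))).
    by rewrite ler_wpM2r ?rnorm_ge0// lerDl.
  by rewrite mulrC -ltr_pdivlMr.
by apply: ext_eq => e e0; exists v; rewrite subrr rnorm0.
Qed.

End ContinuousExtension.

(** If the ball of radius [e] is mapped into the unit ball, rescaling [v] to norm [e / 2] gives the
    constant [2 / e]; half the radius is used because the ball is open. *)
Lemma continuous_linear_rnorm_le (R : realType) (k : scalar_kind)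
    (V W : normedModType (scalars R k)) (f : {linear V -> W}) : continuous f ->
  exists2 C : R, 0 < C & forall v, rnorm (f v) <= C * rnorm v.
Proof.
move=> fc; have : nbhs (0 : V) [set v | rnorm (f v) < 1].
  have /cvg_rnorm/(_ 1 ltr01) : f v @[v --> (0 : V)] --> f 0 by exact: fc.
  by apply: filterS => v; rewrite linear0 subr0.
move=> /nbhs_rnorm[e e0 ef]; exists (2 / e) => [|v]; first by rewrite divr_gt0.
have [->|v0] := eqVneq v 0; first by rewrite linear0 !rnorm0 mulr0.
have rv0 : 0 < rnorm v.
  rewrite lt_neqAle rnorm_ge0 andbT eq_sym; apply: contra_neq v0; exact: rnorm_eq0.
pose c := e / 2 / rnorm v.
have c0 : 0 < c by rewrite !divr_gt0.
have rc : rnorm (of_real k c) = c by rewrite rnorm_of_real gtr0_norm.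
have /ef /= : rnorm (of_real k c *: v - 0) < e.
  rewrite subr0 rnormZ rc /c divfK ?gt_eqF// gtr_pMr// invf_lt1// ltr1n.
  by [].
rewrite linearZ /= rnormZ rc mulrC -ltr_pdivlMr// mul1r => /ltW/le_trans; apply.
suff -> : 2 / e * rnorm v = c^-1 by [].
by rewrite /c; field; rewrite !gt_eqF.
Qed.

(** * The dual ball *)

Section BoundedMultilinear.
Context (R : realType) (k : scalar_kind) (m : nat).
Local Notation K := (scalars R k).
Context (X : 'I_m -> completeNormedModType K).
Variable f : (forall j, X j) -> K^o.
Hypotheses (f_multilinear : multilinear f)
  (f_le : forall x, rnorm (f x) <= \prod_(j < m) rnorm (x j)).

(** Coordinates are exchanged one at a time, so that [f y - f x] telescopes into [m] terms, each
    with a single entry [y i - x i]. *)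
Let hybrid (x y : forall j, X j) (n : nat) : forall j, X j :=
  fun j => if (j < n)%N then y j else x j.

Let f_sub x (j : 'I_m) (u v : X j) :
  f (dfwith x j u) - f (dfwith x j v) = f (dfwith x j (u - v)).
Proof.
have := @f_multilinear x j (- 1) v u.
by rewrite scaleN1r (addrC _ u) => ->; rewrite scaleN1r addrC.
Qed.

Let hybridS x y (i : 'I_m) : hybrid x y i.+1 = dfwith (hybrid x y i) i (y i).
Proof.
apply: functional_extensionality_dep => j; rewrite /hybrid.
case: dfwithP => [|j' ij']; first by rewrite ltnS leqnn.
move: ij'; rewrite -val_eqE eq_sym => /negbTE ij'.
by rewrite ltnS leq_eqVlt -[_ == _]/(val j' == val i) ij'.
Qed.

Let hybrid_id x y (i : 'I_m) : hybrid x y i = dfwith (hybrid x y i) i (x i).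
Proof.
apply: functional_extensionality_dep => j; rewrite /hybrid.
by case: dfwithP => //; rewrite ltnn.
Qed.

(** In the compactness proof a cluster point is only known to be a bounded multilinear form, while
    members of the dual ball must be continuous. *)
Lemma bounded_multilinear_continuous : continuous (f : prod_topology X -> K^o).
Proof.
(* [B] bounds all entries of [x], and those of any [y] within distance 1 of it. *)
move=> x; pose B := 1 + \sum_(j < m) rnorm (x j).
have xB (j : 'I_m) : rnorm (x j) + 1 <= B.
  rewrite addrC lerD2l (bigD1 j)//= lerDl.
  by apply: sumr_ge0 => i _; exact: rnorm_ge0.
have B1 : 1 <= B by rewrite lerDl sumr_ge0// => i _; exact: rnorm_ge0.
have B0 : 0 < B by exact: lt_le_trans B1.
have diff_le y d : 0 <= d -> d <= 1 -> (forall j, rnorm (y j - x j) <= d) ->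
    rnorm (f y - f x) <= d * B ^+ m *+ m.
  move=> d0 d1 yx.
  have -> : f y - f x = \sum_(i < m) f (dfwith (hybrid x y i) i (y i - x i)).
    have -> : f y = f (hybrid x y m).
      by congr f; apply: functional_extensionality_dep => j; rewrite /hybrid ltn_ord.
    have -> : f x = f (hybrid x y 0).
      by congr f; apply: functional_extensionality_dep => j.
    rewrite -(telescope_sumr (fun n => f (hybrid x y n)))// big_mkord.
    by apply: eq_bigr => i _; rewrite hybridS [X in _ - f X]hybrid_id f_sub.
  apply: le_trans (rnorm_sum _) _.
  rewrite -[X in _ *+ X]card_ord -sumr_const; apply: ler_sum => i _.
  apply: le_trans (f_le _) _; rewrite (bigD1 i)//= dfwithin.
  apply: ler_pM; [exact: rnorm_ge0| |exact: yx|].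
    by apply: prodr_ge0 => j _; exact: rnorm_ge0.
  apply: (@le_trans _ _ (\prod_(j < m | j != i) B)).
    apply: ler_prod => j ji; rewrite rnorm_ge0 /= dfwithout 1?eq_sym// /hybrid.
    case: ifP => _; last by apply: le_trans (xB j); rewrite lerDl.
    rewrite -[y j](subrK (x j)); apply: le_trans (rnormD _ _) _.
    by rewrite addrC; apply: le_trans (xB j); rewrite lerD2l (le_trans (yx j)).
  (* One factor is spent on [d]; as [B >= 1], the power of the remaining ones may be raised to
     [m]. *)
  rewrite prodr_const ler_weXn2l//.
  by apply: leq_trans (max_card _) _; rewrite card_ord.
apply: (cvg_rnorm (nbhs_filter (x : prod_topology X)) _ _).2 => e e0.
(* [m + 1] in place of [m] makes the final inequality strict and the divisor positive for every
   [m]. *)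
have BM : 0 < B ^+ m *+ m.+1 by rewrite pmulrn_lgt0 ?exprn_gt0.
pose d := Num.min 1 (e / (B ^+ m *+ m.+1)).
have d0 : 0 < d by rewrite lt_min ltr01 divr_gt0.
have d1 : d <= 1 by rewrite ge_min lexx.
have de : d * B ^+ m *+ m < e.
  apply: (@lt_le_trans _ _ (d * (B ^+ m *+ m.+1))).
    rewrite -mulrnAr ltr_pM2l// ltr_pMn2l ?exprn_gt0//.
  by rewrite -ler_pdivlMr// ge_min lexx orbT.
have nbx : \forall y \near (x : prod_topology X), forall j, rnorm (y j - x j) < d.
  apply: (@filter_forall _ _ (fun j y => rnorm (y j - x j) < d) _
    (nbhs_filter (x : prod_topology X))) => j.
  have xj : proj j y @[y --> (x : prod_topology X)] --> x j.
    exact: proj_continuous.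
  exact: (cvg_rnorm (nbhs_filter (x : prod_topology X)) _ _).1 xj d d0.
apply: (@filterS _ _ (nbhs_filter (x : prod_topology X))) nbx => y yx.
by apply: le_lt_trans de; apply: diff_le => [||j]//; [exact: ltW|exact/ltW/yx].
Qed.

End BoundedMultilinear.

Section DualBall.
Context (R : realType) (k : scalar_kind) (m : nat).
Local Notation K := (scalars R k).
Context (X : 'I_m -> completeNormedModType K).
Local Notation B := (dual_ball X).
Local Notation emb := (@weak_star_embedding R k m X).

Lemma weak_star_continuous : continuous emb.
Proof. exact: initial_continuous. Qed.

Lemma pairing_continuous (u : tensor X) : continuous (fun phi : B => pairing phi u).
Proof.
move=> phi; apply: (@continuous_comp _ _ _ emb (fun g : {ptws tensor X -> K^o} => g u)).
  exact: weak_star_continuous.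
exact: proj_continuous.
Qed.

Lemma pairing_pure (f : (forall j, X j) -> K^o) x : pairing f [:: (1, x)] = f x.
Proof. by rewrite /pairing big_seq1 scale1r. Qed.

Lemma projective_norm_pure (x : forall j, X j) :
  projective_norm [:: (1, x)] <= \prod_(j < m) rnorm (x j).
Proof.
have -> : \prod_(j < m) rnorm (x j) =
    \sum_(t <- [:: (1 : K, x)]) rnorm t.1 * \prod_(j < m) rnorm (t.2 j).
  by rewrite big_seq1 -(of_real1 R k) rnorm_of_real normr1 mul1r.
apply: ge_inf; last by exists [:: (1, x)].
exists 0 => _ [w _ <-]; apply: sumr_ge0 => t _.
by rewrite mulr_ge0 ?rnorm_ge0//; apply: prodr_ge0 => j _; exact: rnorm_ge0.
Qed.

(** Pairings are continuous, and those with pure tensors determine the form. *)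
Lemma dual_ball_hausdorff : hausdorff_space B.
Proof.
move=> phi psi phipsi; have ev u : pairing phi u = pairing psi u.
  apply: (@norm_hausdorff _ K^o) => U V Uphi Vpsi.
  have [chi [Uchi Vchi]] := phipsi _ _ (pairing_continuous Uphi) (pairing_continuous Vpsi).
  by exists (pairing chi u).
have {ev} fE : dual_form phi = dual_form psi.
  by apply/funext => x; rewrite -!pairing_pure ev.
case: phi psi fE {phipsi} => [f f1 f2 f3] [g g1 g2 g3] /= fg.
by subst g; congr DualBall; exact: Prop_irrelevance.
Qed.

(** The embedding lands in a product of compact balls indexed by formal sums. What remains is that a
    cluster point [g], a mere function on formal sums, is the pairing with an element of the
    ball. *)
Lemma dual_ball_compact : compact [set: B].
Proof.
move=> F FF _.
pose A := [set g : {ptws tensor X -> K^o} | forall u, rnorm (g u) <= projective_norm u].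
have cA : compact A.
  apply: (@tychonoff (tensor X) (fun=> K^o)
    (fun u => [set a | rnorm a <= projective_norm u])) => u.
  exact: rnorm_ball_compact.
have FA : F (emb @^-1` A).
  by apply: filterS (@filterT _ F _) => phi _ u; exact: form_le1.
have [g [Ag gF]] := cA (emb @ F) _ FA.
(* [g] lies in the closure of the range of the embedding, so identities between continuous functions
   that hold on the range hold at [g]. Multilinearity is transported this way. *)
have g_eq (h1 h2 : {ptws tensor X -> K^o} -> K^o) : continuous h1 -> continuous h2 ->
    (forall phi : B, h1 (emb phi) = h2 (emb phi)) -> h1 g = h2 g.
  move=> h1c h2c h12; apply: (@norm_hausdorff _ K^o) => U V Uh Vh.
  have FE : F (emb @^-1` range emb).
    by apply: filterS (@filterT _ F _) => phi _; exists phi.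
  have gUV : nbhs g (h1 @^-1` U `&` h2 @^-1` V).
    by apply: filterI; [exact: h1c|exact: h2c].
  have [_ [[phi _ <-] [Uphi Vphi]]] := gF _ _ FE gUV.
  by exists (h1 (emb phi)); split; rewrite // h12.
have evc (u : tensor X) : continuous (fun h : {ptws tensor X -> K^o} => h u).
  exact: proj_continuous.
pose f (x : forall j, X j) : K^o := g [:: (1, x)].
have g_pairing u : g u = pairing f u.
  rewrite /pairing /f.
  apply: (g_eq (fun h => h u) (fun h => \sum_(t <- u) t.1 *: h [:: (1, t.2)])).
  - exact: evc.
  - have tc (t : K * (forall j, X j)) :
        continuous (fun h : {ptws tensor X -> K^o} => t.1 *: h [:: (1, t.2)]).
      move=> h; apply: (@continuous_comp _ _ _ (fun h : {ptws tensor X -> K^o} =>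
        h [:: (1, t.2)]) (fun b : K^o => t.1 *: b)); first exact: evc.
      exact: (@scaler_continuous K K^o).
    exact: (@continuous_big K^o _ +%R 0 xpredT (@add_continuous K^o)
      {ptws tensor X -> K^o} u _ (fun t _ => tc t)).
  - by move=> phi; apply: eq_bigr => t _; rewrite /weak_star_embedding pairing_pure.
have f_multi : multilinear f.
  move=> x j a v w; apply: (g_eq (fun h => h [:: (1, dfwith x j (a *: v + w))])
    (fun h => a *: h [:: (1, dfwith x j v)] + h [:: (1, dfwith x j w)])).
  - exact: evc.
  - have avc : continuous (fun h : {ptws tensor X -> K^o} => a *: h [:: (1, dfwith x j v)]).
      move=> h; apply: (@continuous_comp _ _ _ (fun h : {ptws tensor X -> K^o} =>
        h [:: (1, dfwith x j v)]) (fun b : K^o => a *: b)); first exact: evc.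
      exact: (@scaler_continuous K K^o).
    move=> h; exact: (cvgD (avc h) (evc [:: (1, dfwith x j w)] h)).
  - by move=> phi; rewrite /weak_star_embedding !pairing_pure; exact: form_multilinear.
have f_le x : rnorm (f x) <= \prod_(j < m) rnorm (x j).
  exact: le_trans (Ag _) (projective_norm_pure x).
have f_le1 u : rnorm (pairing f u) <= projective_norm u.
  by rewrite -g_pairing; exact: Ag.
pose phi : B := DualBall f_multi (bounded_multilinear_continuous f_multi f_le) f_le1.
have embphi : emb phi = g by apply/funext => u; rewrite g_pairing.
(* The topology is initial for the embedding, so a neighbourhood of [phi] contains the preimage of
   an open [W] around [g], where the cluster property applies. *)
exists phi; split=> // C U FC; rewrite nbhsE => -[_ [[W oW <-] Wphi] WU].
have FC' : F (emb @^-1` (emb @` C)) by apply: filterS FC => psi Cpsi; exists psi.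
have nW : nbhs g W by apply: open_nbhs_nbhs; split=> //; rewrite -embphi.
by have [_ [[psi Cpsi <-] Wpsi]] := gF _ _ FC' nW; exists psi; split=> //; exact: WU.
Qed.

End DualBall.

(** * Domination *)

Lemma sum_integral_le d (T : measurableType d) (R : realType)
    (P : probability T R) n (f : 'I_n -> T -> R) (c : R) :
  (forall i, measurable_fun setT (f i)) -> (forall i x, 0 <= f i x) ->
  (forall x, \sum_(i < n) f i x <= c) ->
  (\sum_(i < n) \int[P]_x (f i x)%:E <= c%:E)%E.
Proof.
move=> mf f0 fc; rewrite -ge0_integral_sum//; last 2 first.
- by move=> i; apply/measurable_EFinP; exact: mf.
- by move=> i x _; rewrite lee_fin f0.
apply: (@le_trans _ _ (\int[P]_x (cst c%:E x))%E); last first.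
  by rewrite integral_cst//= probability_setT mule1.
apply: ge0_le_integral => //.
- by move=> x _; apply: sume_ge0 => i _; rewrite lee_fin f0.
- by apply: emeasurable_sum => i; apply/measurable_EFinP; exact: mf.
- by move=> x _; rewrite sumEFin lee_fin.
Qed.

Section Domination.
Context (R : realType) (k : scalar_kind) (m : nat).
Local Notation K := (scalars R k).
Context (X : 'I_m -> completeNormedModType K) (p : R) (p_ge1 : 1 <= p).
Context (Phi : Vm X -> continuousType (dual_ball X) K^o).
Hypotheses (Phi_homogeneous : homogeneous Phi) (Phi_bounded : bounded_map Phi).
Local Notation B := (dual_ball X).

Let p0 : 0 < p. Proof. exact: lt_le_trans p_ge1. Qed.
Let pV0 : 0 < p^-1. Proof. by rewrite invr_gt0. Qed.

Lemma powRK (a : R) : 0 <= a -> (a `^ p) `^ p^-1 = a.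
Proof. by move=> a0; rewrite -powRrM divff ?gt_eqF// powRr1. Qed.

Lemma powRVK (a : R) : 0 <= a -> (a `^ p^-1) `^ p = a.
Proof. by move=> a0; rewrite -powRrM mulVf ?gt_eqF// powRr1. Qed.

Lemma ler_powR2 (r a b : R) : 0 < r -> 0 <= a -> 0 <= b ->
  (a `^ r <= b `^ r) = (a <= b).
Proof.
move=> r0 a0 b0; apply/idP/idP => [|ab].
  by rewrite !leNgt; apply: contra => ba; apply: gt0_ltr_powR.
by apply: ge0_ler_powR; rewrite ?nnegrE// ltW.
Qed.

(** The supremum of an unbounded set is a default value, hence the explicit bound [M]. *)
Lemma sup_norm_ge (g : B -> R) M phi : (forall phi, `|g phi| <= M) ->
  `|g phi| <= sup_norm g.
Proof.
move=> gM; apply: sup_upper_bound; last by exists phi.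
by split; [exists `|g phi|, phi | exists M => _ [psi _ <-]].
Qed.

Lemma sup_norm_le (g : B -> R) M : (forall phi, `|g phi| <= M) -> sup_norm g <= M.
Proof.
move=> gM; apply: ge_sup; first by exists `|g point|, point.
by move=> _ [phi _ <-].
Qed.

Definition Phi_norm (v : Vm X) (phi : B) : R := rnorm (Phi v phi).

Lemma Phi_norm_ge0 v phi : 0 <= Phi_norm v phi.
Proof. exact: rnorm_ge0. Qed.

Lemma Phi_norm_continuous v : continuous (Phi_norm v).
Proof.
move=> phi; apply: (@continuous_comp _ _ _ (Phi v) (@rnorm R k K^o)).
  exact: cts_fun.
exact: rnorm_continuous.
Qed.

Lemma Phi_norm_bounded v : exists2 M : R, 0 <= M & forall phi, Phi_norm v phi <= M.
Proof.
have := continuous_compact (continuous_subspaceT (@Phi_norm_continuous v))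
  (@dual_ball_compact R k m X).
move=> /compact_bounded[M [Mreal MP]].
exists (`|M| + 1) => [|phi]; first by rewrite addr_ge0.
apply: le_trans (ler_norm _) _; apply: MP; last by exists phi.
by rewrite (le_lt_trans (ler_norm _))// ltrDl.
Qed.

Lemma Phi0 phi : Phi 0 phi = 0.
Proof.
have [M PM] := Phi_bounded; have [c c0 Pc] := Phi_norm_bounded 0.
apply: rnorm_eq0; apply/eqP; rewrite eq_le rnorm_ge0 andbT.
have n0 : normC (0 : Vm X) = 0.
  apply/eqP; rewrite eq_le; apply/andP; split.
    by apply: sup_norm_le => psi; rewrite [(0 : Vm X) psi](_ : _ = 0)// rnorm0 normr0.
  apply: le_trans (@sup_norm_ge (fun psi => rnorm ((0 : Vm X) psi)) 0 point _) => //.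
  by move=> psi; rewrite [(0 : Vm X) psi](_ : _ = 0)// rnorm0 normr0.
have := PM 0; rewrite n0 mulr0; apply: le_trans.
rewrite -[leLHS]ger0_norm ?rnorm_ge0//.
apply: (@sup_norm_ge (fun psi => rnorm (Phi 0 psi)) c phi) => psi.
by rewrite ger0_norm ?rnorm_ge0// Pc.
Qed.

Lemma Phi_normZ (r : R) v phi : 0 < r ->
  Phi_norm (of_real k r *: v) phi = r * Phi_norm v phi.
Proof.
move=> r0; rewrite /Phi_norm Phi_homogeneous; last first.
  by rewrite -(of_real0 R k) lt_of_real.
by rewrite rnormZ rnorm_of_real gtr0_norm.
Qed.

Definition Phi_pow (v : Vm X) (phi : B) : R := Phi_norm v phi `^ p.

Lemma Phi_pow_ge0 v phi : 0 <= Phi_pow v phi. Proof. exact: powR_ge0. Qed.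

Lemma Phi_pow_bounded v : (Phi_pow v : B -> R^o) \in @bounded_pred R B.
Proof.
have [M M0 PM] := Phi_norm_bounded v; apply/asboolP; exists (M `^ p) => phi.
rewrite ger0_norm ?powR_ge0//.
by apply: ge0_ler_powR; rewrite ?nnegrE ?(ltW p0) ?Phi_norm_ge0.
Qed.

Lemma Phi_powZ (t : R) v phi : 0 < t ->
  Phi_pow (of_real k (t `^ p^-1) *: v) phi = t * Phi_pow v phi.
Proof.
move=> t0; rewrite /Phi_pow Phi_normZ ?powR_gt0//.
by rewrite powRM ?powR_ge0 ?Phi_norm_ge0// powRVK// ltW.
Qed.

(** For [c > 0] a p-th root turns the condition into [c^(1/p) <= Phi_norm v phi], which is closed by
    continuity. *)
Lemma Phi_pow_superlevel v c : 0 < c -> closed [set phi | c <= Phi_pow v phi].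
Proof.
move=> c0.
have -> : [set phi | c <= Phi_pow v phi] = Phi_norm v @^-1` [set x | c `^ p^-1 <= x].
  apply/funext => phi; apply/propext => /=.
  by rewrite -{1}[c]powRVK ?ler_powR2 ?powR_ge0 ?Phi_norm_ge0// ltW.
apply: closed_comp; last exact: closed_ge.
by move=> phi _; exact: Phi_norm_continuous.
Qed.

Lemma Phi_pow_measurable v :
  measurable_fun setT (Phi_pow v : borel_dual_ball X -> R).
Proof.
apply: closed_superlevel_measurable => c.
have [c0|] := leP c 0; last exact: Phi_pow_superlevel.
rewrite (_ : mkset _ = setT); first exact: closedT.
by apply/seteqP; split=> // phi _; exact: le_trans (Phi_pow_ge0 _ _).
Qed.

Section Integral.
Variable eta : probability (borel_dual_ball X) R.
Local Open Scope ereal_scope.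

Definition Phi_int v : \bar R := \int[eta]_phi (Phi_pow v phi)%:E.

Lemma Phi_int_ge0 v : 0 <= Phi_int v.
Proof. by apply: integral_ge0 => phi _; rewrite lee_fin Phi_pow_ge0. Qed.

Lemma sum_Phi_int_le n (v : 'I_n -> Vm X) (c : R) :
  (forall phi, \sum_(i < n) Phi_pow (v i) phi <= c)%R ->
  \sum_(i < n) Phi_int (v i) <= c%:E.
Proof.
move=> vc; apply: sum_integral_le => // [i|i phi].
  exact: Phi_pow_measurable.
exact: Phi_pow_ge0.
Qed.

Lemma Phi_int_fin v : Phi_int v \is a fin_num.
Proof.
have /asboolP[M PM] := Phi_pow_bounded v.
rewrite ge0_fin_numE ?Phi_int_ge0//; apply: (@le_lt_trans _ _ M%:E); last exact: ltry.
have := @sum_Phi_int_le 1 (fun=> v) M; rewrite big_ord1; apply => phi.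
by rewrite big_ord1; exact: le_trans (ler_norm _) (PM phi).
Qed.

Lemma Lnorm_Phi v : Lnorm eta p%:E (fun phi => (rnorm (Phi v phi))%:E) =
  (fine (Phi_int v) `^ p^-1)%:E.
Proof.
rewrite unlock -poweR_EFin fineK ?Phi_int_fin//; congr poweR.
by apply: eq_integral => phi _; rewrite abse_EFin poweR_EFin ger0_norm ?rnorm_ge0.
Qed.

(** The one-term decomposition competes in the infimum; being finite, it also ensures that [fine]
    does not replace an infinite value by 0. *)
Lemma domination_norm_le v : (domination_norm Phi p eta v <= fine (Phi_int v) `^ p^-1)%R.
Proof.
rewrite /domination_norm; set I := ereal_inf _.
have Ile : I <= (fine (Phi_int v) `^ p^-1)%:E.
  apply: ereal_inf_lbound; exists 1%N, (fun=> v); rewrite !big_ord1.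
  by rewrite Lnorm_Phi.
have I0 : 0 <= I.
  apply: le_ereal_inf_tmp => _ [r [w [_ ->]]]; apply: sume_ge0 => i _.
  exact: Lnorm_ge0.
rewrite -lee_fin fineK// ge0_fin_numE//; apply: le_lt_trans Ile _; exact: ltry.
Qed.

Lemma domination_norm_ge v (c : R) :
  (forall r (w : 'I_r -> Vm X), v = (\sum_(i < r) w i)%R ->
    (c <= \sum_(i < r) fine (Phi_int (w i)) `^ p^-1)%R) ->
  (c <= domination_norm Phi p eta v)%R.
Proof.
move=> cw; rewrite /domination_norm; set I := ereal_inf _.
have Ile : I <= (fine (Phi_int v) `^ p^-1)%:E.
  apply: ereal_inf_lbound; exists 1%N, (fun=> v); rewrite !big_ord1.
  by rewrite Lnorm_Phi.
have cI : c%:E <= I.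
  apply: le_ereal_inf_tmp => _ [r [w [vw ->]]].
  under eq_bigr do rewrite Lnorm_Phi.
  by rewrite sumEFin lee_fin cw.
rewrite -lee_fin fineK//; move: Ile cI; case: I => [r| |] //=.
Qed.

End Integral.

End Domination.

(** * Linearization of a summing map on the span of elementary functions *)

Section Linearization.
Context (R : realType) (k : scalar_kind) (m : nat).
Local Notation K := (scalars R k).
Context (X : 'I_m -> completeNormedModType K) (Y : completeNormedModType K).
Context (p : R) (p_ge1 : 1 <= p) (T : (forall j, X j) -> Y).
Context (Phi : Vm X -> continuousType (dual_ball X) K^o).
Hypothesis Phi_bounded : bounded_map Phi.
Local Notation B := (dual_ball X).
Variable C : R.
Hypotheses (C_gt0 : 0 < C) (T_summing :
  forall (n1 n2 : nat) (x : 'I_n1 -> 'I_n2 -> forall j, X j)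
         (a : 'I_n1 -> 'I_n2 -> K),
    (\sum_(i < n1) rnorm (\sum_(l < n2) a i l *: T (x i l)) `^ p) `^ p^-1
    <= C * sup_norm (fun phi =>
         (\sum_(i < n1) rnorm (Phi (\sum_(l < n2) a i l *: i_m (x i l)) phi) `^ p)
           `^ p^-1)).

Let p0 : 0 < p. Proof. exact: lt_le_trans p_ge1. Qed.
Let pV0 : 0 < p^-1. Proof. by rewrite invr_gt0. Qed.

Let span_Vm (u : tensor X) : Vm X := \sum_(t <- u) t.1 *: i_m t.2.
Let span_T (u : tensor X) : Y := \sum_(t <- u) t.1 *: T t.2.

(** The summing inequality takes rectangular families, whereas formal sums differ in length; padding
    with coefficient 0 changes no sum. *)
Let d0 : K * (forall j, X j) := (0, fun=> 0).

Let tensor_nth (W : lmodType K) (F : (forall j, X j) -> W) (u : tensor X) n :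
  (size u <= n)%N ->
  \sum_(t <- u) t.1 *: F t.2 =
  \sum_(l < n) (nth d0 u l).1 *: F (nth d0 u l).2.
Proof.
move=> un; rewrite (big_nth d0) -(big_mkord xpredT
  (fun l => (nth d0 u l).1 *: F (nth d0 u l).2)).
rewrite (@big_cat_nat _ _ _ (size u) 0 n) //= [X in _ = _ + X]big1_seq ?addr0// => l /andP[_].
by rewrite mem_index_iota => /andP[ul _]; rewrite nth_default// scale0r.
Qed.

(** The sup norm is replaced by a pointwise bound [c] and the roots are removed, the form that can
    be compared with sums of gaps. *)
Lemma summing_tensors n (u : 'I_n -> tensor X) (c : R) :
  (forall phi, \sum_(i < n) Phi_pow p Phi (span_Vm (u i)) phi <= c) ->
  \sum_(i < n) rnorm (span_T (u i)) `^ p <= C `^ p * c.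
Proof.
move=> uc; have c0 : 0 <= c.
  by apply: le_trans (uc point); apply: sumr_ge0 => i _; exact: powR_ge0.
pose N := \max_(i < n) size (u i).
have uN i : (size (u i) <= N)%N by rewrite (leq_bigmax (F := fun i => size (u i))).
have := T_summing (fun i (l : 'I_N) => (nth d0 (u i) l).2)
  (fun i (l : 'I_N) => (nth d0 (u i) l).1).
under [in X in X <= _]eq_bigr do rewrite -tensor_nth//.
set s := sup_norm _ => us.
have sc : s <= c `^ p^-1.
  apply: sup_norm_le => phi; rewrite ger0_norm ?powR_ge0//.
  under eq_bigr do rewrite -tensor_nth//.
  rewrite ler_powR2//; first exact: uc.
  by apply: sumr_ge0 => i _; exact: powR_ge0.
have S0 : 0 <= \sum_(i < n) rnorm (span_T (u i)) `^ p.
  by apply: sumr_ge0 => i _; exact: powR_ge0.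
rewrite -(ler_powR2 pV0)//; last by rewrite mulr_ge0 ?powR_ge0.
rewrite powRM ?powR_ge0// powRK// ?(ltW C_gt0)//.
by apply: le_trans us _; rewrite ler_wpM2l// ltW.
Qed.

(** One formal sum and [c = 0], with [Phi 0 = 0]. This makes the linearization independent of the
    chosen representation. *)
Lemma span_T_eq0 u : span_Vm u = 0 -> span_T u = 0.
Proof.
move=> u0; have := @summing_tensors 1 (fun=> u) 0; rewrite !big_ord1 mulr0 => h.
apply: rnorm_eq0; apply/eqP; rewrite eq_le rnorm_ge0 andbT.
rewrite -(ler_powR2 p0) ?rnorm_ge0// (powR0 (lt0r_neq0 p0)); apply: h => phi.
by rewrite big_ord1 u0 /Phi_pow /Phi_norm Phi0// rnorm0 powR0// gt_eqF.
Qed.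

Let span_VmD a u w : span_Vm ([seq (a * t.1, t.2) | t <- u] ++ w) =
  a *: span_Vm u + span_Vm w.
Proof.
rewrite /span_Vm big_cat big_map scaler_sumr; congr (_ + _).
by apply: eq_bigr => t _; rewrite scalerA.
Qed.

Let span_TD a u w : span_T ([seq (a * t.1, t.2) | t <- u] ++ w) =
  a *: span_T u + span_T w.
Proof.
rewrite /span_T big_cat big_map scaler_sumr; congr (_ + _).
by apply: eq_bigr => t _; rewrite scalerA.
Qed.

Lemma span_T_eq u w : span_Vm u = span_Vm w -> span_T u = span_T w.
Proof.
move=> uw; have := @span_T_eq0 ([seq (-1 * t.1, t.2) | t <- u] ++ w).
rewrite span_VmD span_TD uw !scaleN1r addNr => /(_ erefl)/eqP.
by rewrite addrC subr_eq0 eq_sym => /eqP.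
Qed.

Lemma span_VmP v : exists u, span_Vm u = v.
Proof.
have /asboolP[n [a [x vE]]] := Vm_funP v.
exists [seq (a i, x i) | i <- index_enum 'I_n].
apply/val_inj; rewrite /= vE /span_Vm big_map.
by rewrite (big_morph (@Vm_fun R k m X) (op1 := +%R) (id1 := 0)).
Qed.

Let repr_Vm v : tensor X := sval (cid (span_VmP v)).

Let repr_VmK v : span_Vm (repr_Vm v) = v. Proof. exact: (svalP (cid (span_VmP v))). Qed.

Let lin (v : Vm X) : Y := span_T (repr_Vm v).

Let lin_span u : lin (span_Vm u) = span_T u.
Proof. by apply: span_T_eq; rewrite repr_VmK. Qed.

Let lin_linear : linear lin.
Proof.
move=> a v w; rewrite -[v]repr_VmK -[w]repr_VmK -span_VmD !lin_span.
exact: span_TD.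
Qed.

HB.instance Definition _ := GRing.isLinear.Build K (Vm X) Y *:%R lin lin_linear.

Lemma summing_linearization : exists S : {linear Vm X -> Y},
  (forall x, S (i_m x) = T x) /\
  forall n (v : 'I_n -> Vm X) (c : R),
    (forall phi, \sum_(i < n) Phi_pow p Phi (v i) phi <= c) ->
    \sum_(i < n) rnorm (S (v i)) `^ p <= C `^ p * c.
Proof.
exists lin; split=> [x|n v c vc].
  have := lin_span [:: (1, x)].
  by rewrite /span_Vm /span_T !big_seq1 !scale1r.
apply: summing_tensors => phi.
by under eq_bigr do rewrite repr_VmK.
Qed.

End Linearization.

(** * The dominating measure *)

Section PietschDomination.
Context (R : realType) (k : scalar_kind) (m : nat).
Local Notation K := (scalars R k).
Context (X : 'I_m -> completeNormedModType K) (Y : completeNormedModType K).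
Context (p : R) (p_ge1 : 1 <= p).
Context (Phi : Vm X -> continuousType (dual_ball X) K^o).
Hypothesis Phi_homogeneous : homogeneous Phi.
Local Notation B := (dual_ball X).
Context (S : {linear Vm X -> Y}) (C : R) (C_gt0 : 0 < C).
Hypothesis S_summing : forall n (v : 'I_n -> Vm X) (c : R),
    (forall phi, \sum_(i < n) Phi_pow p Phi (v i) phi <= c) ->
    \sum_(i < n) rnorm (S (v i)) `^ p <= C `^ p * c.

Let p0 : 0 < p. Proof. exact: lt_le_trans p_ge1. Qed.
Let CP0 : 0 < C `^ p. Proof. exact: powR_gt0. Qed.

Let gap (v : Vm X) (phi : B) : R := C `^ p * Phi_pow p Phi v phi - rnorm (S v) `^ p.

Let gapZ t v phi : 0 < t -> gap (of_real k (t `^ p^-1) *: v) phi = t * gap v phi.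
Proof.
move=> t0; rewrite /gap Phi_powZ// linearZ /= rnormZ rnorm_of_real ger0_norm ?powR_ge0//.
by rewrite powRM ?powR_ge0 ?rnorm_ge0// powRVK// ?(ltW t0)//; ring.
Qed.

(** A bound [c] on the sum of gaps rearranges into a pointwise bound on the sum of the [Phi_pow];
    the summing inequality then returns [sum |S v|^p <= c + sum |S v|^p]. *)
Let gap_sum_ge0 (s : seq (Vm X)) c :
  (forall phi, \sum_(v <- s) gap v phi <= c) -> 0 <= c.
Proof.
move=> sc; have := @S_summing (size s) (fun i => nth 0 s i)
  ((c + \sum_(v <- s) rnorm (S v) `^ p) / C `^ p).
rewrite [C `^ p * (_ / _)]mulrC divfK ?gt_eqF// (big_nth 0) big_mkord.
suff h phi : \sum_(i < size s) Phi_pow p Phi s`_i phi <=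
    (c + \sum_(i < size s) rnorm (S s`_i) `^ p) / C `^ p.
  by move=> /(_ h); rewrite lerDr.
rewrite ler_pdivlMr// mulrC mulr_sumr -lerBlDr -sumrB.
by have := sc phi; rewrite (big_nth 0) big_mkord.
Qed.

(* Perturbing by sums of gaps makes every functional below [q = inf bounds] nonnegative on
   the gaps, while [gap_sum_ge0] keeps [q] finite. *)
Let bounds (f : bfun R B) : set R :=
  [set c | exists s : seq (Vm X), forall phi, f phi + \sum_(v <- s) gap v phi <= c].

Let q (f : bfun R B) : R := inf (bounds f).

Let bounds_nonempty f : bounds f !=set0.
Proof.
have [M fM] := bfun_bound f; exists M, [::] => phi.
by rewrite big_nil addr0; exact: le_trans (ler_norm _) (fM phi).
Qed.

Let bounds_has_inf f : has_inf (bounds f).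
Proof.
split; first exact: bounds_nonempty.
(* If [|f| <= M] and [f] plus a sum of gaps stays below [c], that sum stays below [c + M], which is
   therefore nonnegative. *)
have [M fM] := bfun_bound f; exists (- M) => c [s sc].
rewrite -subr_ge0 opprK; apply: (gap_sum_ge0 (s := s)) => phi.
by have := sc phi; have := fM phi; rewrite ler_norml => /andP[]; lra.
Qed.

Let q_le (f : bfun R B) c (s : seq (Vm X)) :
  (forall phi, f phi + \sum_(v <- s) gap v phi <= c) -> q f <= c.
Proof. by move=> sc; apply: ge_inf; [have [] := bounds_has_inf f|exists s]. Qed.

(** Lists of gaps concatenate, which gives subadditivity. A positive factor [t] is absorbed into the
    vectors as [t^(1/p)], where the homogeneity of [Phi] enters. *)
Let q_sublinear : sublinear q.
Proof.
split=> [f g|t f t0].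
  rewrite -lerBlDr; apply: lb_le_inf; first exact: bounds_nonempty.
  move=> c [s sc]; rewrite lerBlDl -lerBlDr.
  apply: lb_le_inf; first exact: bounds_nonempty.
  move=> d [r rd]; rewrite lerBlDl; apply: (@q_le _ _ (s ++ r)) => phi.
  by rewrite big_cat bfunD addrACA lerD.
rewrite -ler_pdivrMl//; apply: lb_le_inf; first exact: bounds_nonempty.
move=> c [s sc]; rewrite ler_pdivrMl//.
apply: (@q_le _ _ [seq of_real k (t `^ p^-1) *: v | v <- s]) => phi.
rewrite big_map; under eq_bigr do rewrite gapZ//.
by rewrite -mulr_sumr bfunZ -mulrDr ler_wpM2l// ltW.
Qed.

Lemma pietsch_domination :
  exists eta : probability (borel_dual_ball X) R, regular_measure eta /\
    forall v, ((rnorm (S v) `^ p)%:E <= (C `^ p)%:E * Phi_int p Phi eta v)%E.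
Proof.
have [L [L_linear Lq]] := hahn_banach q_sublinear.
(* The empty list of gaps bounds [q f] by any upper bound of [f]; monotonicity and normalization of
   [L] both come from this. *)
have L_le (c : R) (f : bfun R B) : (forall phi, f phi <= c) -> L f <= c.
  move=> fc; apply: le_trans (Lq f) _; apply: (@q_le _ _ [::]) => phi.
  by rewrite big_nil addr0.
have L_mono (f g : bfun R B) : (forall phi, f phi <= g phi) -> L f <= L g.
  move=> fg; have := L_linear (-1) g f; rewrite mulN1r => Lfg.
  rewrite -subr_le0 addrC -Lfg; apply: L_le => phi.
  by rewrite scaleN1r bfunD bfunN addrC subr_le0.
have L1 : L (bindic R setT) = 1.
  apply/eqP; rewrite eq_le; apply/andP; split.
    by apply: L_le => phi; rewrite /= indicE mem_set.
  rewrite -lerN2 -mulN1r -(linear_functionalZ L_linear); apply: L_le => phi.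
  by rewrite bfunZ /= indicE mem_set// mulr1.
have [eta [eta_reg eta_int]] := positive_functional_measure
  (@dual_ball_compact R k m X) (@dual_ball_hausdorff R k m X) L_linear L_mono L1.
exists eta; split; first exact: eta_reg.
move=> v; pose F := MkBfun (Phi_pow_bounded p_ge1 Phi v).
have SF : rnorm (S v) `^ p <= C `^ p * L F.
  (* The argument of [L] is minus the gap of [v]; adding that gap itself, by the list [[:: v]],
     leaves 0 and so bounds [q] by 0. *)
  have : L (rnorm (S v) `^ p *: bindic R setT + (- C `^ p) *: F) <= 0.
    apply: le_trans (Lq _) _; apply: (@q_le _ _ [:: v]) => phi.
    rewrite big_seq1 bfunD !bfunZ /= indicE mem_set// mulr1 /gap; lra.
  by rewrite (linear_functionalD L_linear) !(linear_functionalZ L_linear) L1 mulr1 mulNr subr_le0.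
apply: (@le_trans _ _ (C `^ p * L F)%:E); first by rewrite lee_fin.
rewrite EFinM lee_pmul2l// ?lte_fin//; apply: eta_int.
  by move=> c c0; exact: Phi_pow_superlevel.
by move=> phi; exact: Phi_pow_ge0.
Qed.

(** Each summand of a decomposition of [v] is dominated separately, and linearity of [S] adds the
    estimates; the constant [C] is the same for all decompositions. *)
Lemma pietsch_domination_norm :
  exists eta : probability (borel_dual_ball X) R, regular_measure eta /\
    forall v, rnorm (S v) <= C * domination_norm Phi p eta v.
Proof.
have [eta [eta_reg eta_dom]] := pietsch_domination; exists eta; split=> // v.
rewrite -ler_pdivrMl//; apply: domination_norm_ge => // r w vw.
rewrite ler_pdivrMl// vw linear_sum /=; apply: le_trans (rnorm_sum _) _.
rewrite mulr_sumr; apply: ler_sum => i _.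
have I0 : 0 <= fine (Phi_int p Phi eta (w i)) by exact/fine_ge0/Phi_int_ge0.
rewrite -(ler_powR2 p0) ?rnorm_ge0 ?mulr_ge0 ?powR_ge0 ?(ltW C_gt0)//.
rewrite powRM ?powR_ge0 ?(ltW C_gt0)// powRVK// -lee_fin EFinM fineK ?Phi_int_fin//.
Qed.

End PietschDomination.

(** * Factorization through the domination space *)

Theorem theorem3p3 (R : realType) (k : scalar_kind) (m : nat)
    (m_gt0 : (0 < m)%N)
    (X : 'I_m -> completeNormedModType (scalars R k))
    (Y : completeNormedModType (scalars R k))
    (p : R) (p_ge1 : 1 <= p)
    (T : (forall j, X j) -> Y) (T_multilinear : multilinear T)
    (Phi : Vm X -> continuousType (dual_ball X) (scalars R k)^o)
    (Phi_homogeneous : homogeneous Phi) (Phi_bounded : bounded_map Phi)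
    (standing_assumption : forall eta : probability (borel_dual_ball X) R,
       regular_measure eta ->
       seminorm (domination_norm Phi p eta) /\
       continuous_on_Vm (domination_norm Phi p eta)) :
  strongly_abstract_summing Phi p T <->
  exists eta : probability (borel_dual_ball X) R,
    regular_measure eta /\
    exists (D : completion (domination_norm Phi p eta)) (That : {linear D -> Y}),
      continuous That /\
      forall x : (forall j, X j), T x = That (quotient_map D (i_m x)).
Proof.
have p0 : 0 < p by exact: lt_le_trans p_ge1.
have pV0 : 0 < p^-1 by rewrite invr_gt0.
split=> [[C C0 T_summing]|[eta [eta_reg [D [That [That_cont TE]]]]]].
  have [S [ST S_summing]] := summing_linearization p_ge1 Phi_bounded C0 T_summing.
  have [eta [eta_reg S_dom]] := pietsch_domination_norm p_ge1 Phi_homogeneous C0 S_summing.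
  exists eta; split=> //.
  have [N_seminorm _] := standing_assumption _ eta_reg.
  have [D] := seminorm_completion N_seminorm; exists D.
  have [That [That_cont ThatE]] := extend_to_completion D (ltW C0) S_dom.
  by exists That; split=> // x; rewrite ThatE ST.
(* Converse: any bound for the operator [That] serves as summing constant, as [eta] has total mass
   1. *)
have [C C0 ThatC] := continuous_linear_rnorm_le That_cont.
exists C => // n1 n2 x a.
pose v i : Vm X := \sum_(l < n2) a i l *: i_m (x i l).
have TS i : \sum_(l < n2) a i l *: T (x i l) = That (quotient_map D (v i)).
  by rewrite /v !linear_sum; apply: eq_bigr => l _; rewrite !linearZ /= TE.
set G := (fun phi => _ : R); set s := sup_norm G.
have GE phi : G phi = (\sum_(i < n1) Phi_pow p Phi (v i) phi) `^ p^-1 by [].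
have G0 phi : 0 <= G phi by exact: powR_ge0.
have sum0 phi : 0 <= \sum_(i < n1) Phi_pow p Phi (v i) phi.
  by apply: sumr_ge0 => i _; exact: powR_ge0.
(* Boundedness of [G] is what makes the supremum [s] a genuine upper bound. *)
have G_bounded : exists M, forall phi, `|G phi| <= M.
  have /choice[M PM] i : exists M, forall phi, `|Phi_pow p Phi (v i) phi| <= M.
    by have /asboolP := Phi_pow_bounded p_ge1 Phi (v i).
  exists ((\sum_(i < n1) M i) `^ p^-1) => phi; rewrite ger0_norm//.
  have le_sum : \sum_(i < n1) Phi_pow p Phi (v i) phi <= \sum_(i < n1) M i.
    by apply: ler_sum => i _; exact: le_trans (ler_norm _) (PM i phi).
  by rewrite GE ler_powR2//; exact: le_trans (sum0 phi) le_sum.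
have Gs phi : G phi <= s.
  have [M GM] := G_bounded.
  by apply: le_trans (ler_norm _) _; exact: sup_norm_ge GM.
have s0 : 0 <= s by exact: le_trans (Gs point).
(* The pointwise inequality [G^p <= s^p] is integrated against a probability, so the constant [s^p]
   is kept. *)
have int_le : (\sum_(i < n1) Phi_int p Phi eta (v i) <= (s `^ p)%:E)%E.
  apply: sum_Phi_int_le => // phi.
  by rewrite -[leLHS](powRVK p_ge1)// ler_powR2 ?powR_ge0// -GE.
have sum_le : \sum_(i < n1) fine (Phi_int p Phi eta (v i)) <= s `^ p.
  rewrite -lee_fin -sumEFin; under eq_bigr do rewrite fineK ?Phi_int_fin//.
  exact: int_le.
rewrite -(ler_powR2 p0) ?powR_ge0 ?mulr_ge0 ?(ltW C0)//.
rewrite powRVK//; last by apply: sumr_ge0 => i _; exact: powR_ge0.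
rewrite powRM ?(ltW C0)//; apply: le_trans (ler_wpM2l (powR_ge0 _ _) sum_le).
rewrite mulr_sumr; apply: ler_sum => i _; rewrite TS.
have I0 : 0 <= fine (Phi_int p Phi eta (v i)) by exact/fine_ge0/Phi_int_ge0.
(* The norm of the class of [v i] is its domination norm, which the one-term decomposition bounds by
   the [L^p] norm of [Phi (v i)]. *)
apply: (@le_trans _ _ ((C * fine (Phi_int p Phi eta (v i)) `^ p^-1) `^ p)).
  rewrite ler_powR2 ?rnorm_ge0 ?mulr_ge0 ?powR_ge0 ?(ltW C0)//.
  apply: le_trans (ThatC _) _; rewrite ler_wpM2l ?(ltW C0)// norm_quotient_map.
  exact: domination_norm_le.
by rewrite powRM ?powR_ge0 ?(ltW C0)// powRVK.
Qed.
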